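(* Let $p$ and $q$ be distinct odd primes with $p>q$ and $p\equiv 1 \pmod q$, and let $N_1,\dots,N_6$ be the six groups of order $2pq$ given by $N_1=C_{2pq}$, $N_2=C_p\times D_q$, $N_3=C_q\times D_p$, $N_4=D_{pq}$, $N_5=C_2\times(C_p\rtimes C_q)$, $N_6=C_p\rtimes C_{2q}$ (with $N_5$ and $N_6$ specified by the presentations in the context). Let $G$ be a finite group and let $i\in\{5,6\}$. If $(G,N_i)$ is admissible, then for every $j$ with $1\le j\le 6$ and $j\ne i$, $$(G,N_j)\text{ is admissible}\iff |G|\text{ divides }2pq(p-1).$$
   Context: $C_m$ denotes the cyclic group of order $m$ and $D_m$ denotes the dihedral group of order $2m$. Let $k$ be an integer of multiplicative order $q$ modulo $p$ (which exists since $p\equiv 1\bmod q$), and write $g^h=hgh^{-1}$. Then $$N_5=C_2\times(C_p\rtimes C_q)=\langle x_5,r_5,s_5\mid x_5^2=r_5^p=s_5^q=1,\ r_5^{s_5}=r_5^k,\ x_5^{s_5}=x_5^{r_5}=x_5\rangle,$$ $$N_6=C_p\rtimes C_{2q}=\langle r_6,s_6\mid r_6^p=s_6^{2q}=1,\ r_6^{s_6}=r_6^{-k}\rangle.$$ For a finite group $N$, let $\mathrm{Perm}(N)$ be the symmetric group on the set $N$, and let $\lambda:N\to\mathrm{Perm}(N)$ be left translation, $\lambda(\eta)(\mu)=\eta\mu$. The holomorph $\mathrm{Hol}(N)$ is the normaliser of $\lambda(N)$ in $\mathrm{Perm}(N)$; it is isomorphic to $N\rtimes\mathrm{Aut}(N)$,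 with $(\eta,\alpha)\in N\rtimes\mathrm{Aut}(N)$ acting on $N$ by $(\eta,\alpha)\cdot\mu=\eta\,\alpha(\mu)$. A subgroup of $\mathrm{Hol}(N)$ is called transitive if it acts transitively on the set $N$. For a finite group $G$ and a group $N$ of order $2pq$, the pair $(G,N)$ is admissible if $G$ is isomorphic to a transitive subgroup of $\mathrm{Hol}(N)$. *)

(* Defs.v *)
From HB Require Import structures.
From mathcomp Require Import all_boot all_order all_algebra all_fingroup all_solvable.

Set Implicit Arguments.
Unset Strict Implicit.
Unset Printing Implicit Defensive.

Local Open Scope group_scope.

Section Holomorph.

Variable N : finGroupType.

(* MathComp composes permutations from left to right, so left_trans is an
   anti-morphism; the sets left_reg and Hol are nevertheless the usual subgroups
   of Perm(N), and passing to the opposite composition does not change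
   isomorphism types. *)
Definition left_trans (eta : N) : {perm N} := perm (mulgI eta).

Definition left_reg : {set {perm N}} := [set left_trans eta | eta in [set: N]].

Definition Hol : {set {perm N}} := 'N(left_reg).

End Holomorph.

Definition admissible (gT : finGroupType) (G : {group gT}) (N : finGroupType) :
    Prop :=
  exists H : {group {perm N}},
    [/\ H \subset Hol N, [transitive H, on [set: N] | 'P] & G \isog H].

(* MathComp's group presentations only have exponents in nat. *)
Definition term_expz (t : Presentation.term) (k : int) : Presentation.term :=
  match k with
  | Posz n => Presentation.Exp t n
  | Negz n => Presentation.Inv (Presentation.Exp t n.+1)
  end.

Notation "x ^~ k" := (term_expz x k)
  (in custom group_presentation at level 29, k constr at level 28).

(* N is isomorphic to the j-th of the six groups N_1, ..., N_6 of order 2pq.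
   - 'D_m is the dihedral group of ORDER m, so D_q is 'D_(2 * q).
   - 'Z_m is the additive group of integers modulo m, for m > 1.
   - N \isog Grp (...) says that N is the largest finite quotient of the
     presented group, hence the presented group itself when it is finite.
   - The source's g^h is h g h^-1 whereas MathComp's x ^ y is y^-1 x y, so
     conjugations are written out. *)
Definition is_N (p q : nat) (k : int) (j : nat) (N : finGroupType) : Prop :=
  match j with
  | 1 => [set: N] \isog [set: 'Z_(2 * p * q)]
  | 2 => [set: N] \isog [set: ('Z_p * 'D_(2 * q))%type]
  | 3 => [set: N] \isog [set: ('Z_q * 'D_(2 * p))%type]
  | 4 => [set: N] \isog 'D_(2 * (p * q))
  | 5 => [set: N] \isog Grp (x : r : s :
           x ^+ 2, r ^+ p, s ^+ q,
           s * r * s^-1 = r ^~ k,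
           s * x * s^-1 = r * x * r^-1 = x)
  | 6 => [set: N] \isog Grp (r : s :
           r ^+ p, s ^+ (2 * q), s * r * s^-1 = r ^~ (- k)%R)
  | _ => False
  end.

(* Main.v *)
Require Import Defs.
From HB Require Import structures.
From mathcomp Require Import all_boot all_order all_algebra all_fingroup all_solvable.
From mathcomp Require Import ring.

(** Let n = 2q, so that 2q divides p - 1 and 2q < p. All six groups act regularly
    on the same set F_p x Z/n: each one is isomorphic to
      M(chi, tau) = { (v, y) |-> (chi(z) v + c, tau_z y) : z in Z/n, c in F_p },
    where the tau_z are the elements of a regular group on Z/n with tau_z 0 = z
    and chi is a multiplicative character of that group. For tau_z y = y + z and
    chi(z) = w^z, the values w = 1, -1, k, -k give N_1, N_3, N_5, N_6; for
    tau_z y = (-1)^z y + z and chi(z) = e^z, the values e = 1, -1 give N_2, N_4.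
    Conjugating Perm(N) to Perm(F_p x Z/n) turns admissibility of (G, N) into:
    G is isomorphic to a transitive subgroup of the normaliser of M(chi, tau)
    ([admissible_regular]). Every element of that normaliser has the form
      (v, y) |-> (d v + u chi(y) + c, t y)   with   chi(t y) = chi(t 0) chi(y),
    because the translations in v are the only elements of order p of M(chi, tau)
    and because the resulting cocycle condition is solved by averaging over Z/n,
    whose order is prime to p ([normaliser_fibred_regular]). Its p-elements are
    the maps with d = 1 and t = 1.

    For i = 5, 6 the permutation t must be a translation, so the normaliser lies
    in a group of order 2 p^2 q (p - 1) ([normaliser_sub_hol]). Hence |G| divides
    2pq(p - 1) exactly when p^2 does not divide |G|.

    If p^2 divides |G|, then every Sylow p-subgroup of G consists of all maps
    (v, y) |-> (v + u chi(y) + c, y). An element of G acts on it with the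
    eigenvalues d (on the constants) and d chi(t 0)^-1, and by transitivity t 0 is
    arbitrary. Hence all e-th powers of elements of G act on p-subgroups as power
    maps if and only if chi^e = 1 ([normaliser_acts_by_powers],
    [acts_by_powers_chi]). This determines the order of chi from G alone. That
    order is 1 or 2 for j <= 4, q for j = 5, 2q for j = 6, so G cannot be
    admissible for both i and j.

    If p^2 does not divide |G|, Hall's theorem conjugates a p-complement of G into
    the group of the maps (d v, y + z). The Sylow p-subgroup, of order p, is
    normalised by an element with z = 1, whose two eigenvalues differ; so it is one
    of the two eigenlines. Up to inversion in N_i, which swaps left and right
    translations and hence the two eigenlines, G lies in
      W = { (v, y) |-> (d v + c, y + z) }   ([transitive_hol_conj]).
    Since W normalises all six regular groups, G is admissible for every N_j. *)

Set Implicit Arguments.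
Unset Strict Implicit.
Unset Printing Implicit Defensive.

Import GRing.Theory.

Local Open Scope group_scope.

(** * Admissibility through a regular permutation group *)

(** With M the left regular representation of N this is admissibility of (G,
    N). *)
Definition transitive_in_normaliser (T : finType) (M : {set {perm T}})
    (gT : finGroupType) (G : {group gT}) : Prop :=
  exists H : {group {perm T}},
    [/\ H \subset 'N(M), [transitive H, on [set: T] | 'P] & G \isog H].

Section Relabel.

Variables (T T' : finType) (h : T -> T') (h' : T' -> T).
Hypotheses (hK : cancel h h') (h'K : cancel h' h).

Lemma relabel_inj (s : {perm T}) : injective (h \o s \o h').
Proof.
exact: inj_comp (inj_comp (can_inj hK) (@perm_inj _ s)) (can_inj h'K).
Qed.

Definition relabel (s : {perm T}) : {perm T'} := perm (@relabel_inj s).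

Lemma relabelE s x : relabel s (h x) = h (s x).
Proof. by rewrite permE /= hK. Qed.

Lemma relabelM : {in [set: {perm T}] &, {morph relabel : s t / s * t}}.
Proof.
by move=> s t _ _; apply/permP=> y; rewrite -[y]h'K permM !relabelE permM.
Qed.
Canonical relabel_morphism := Morphism relabelM.

Lemma injm_relabel : 'injm relabel.
Proof.
apply/injmP=> s t _ _ eq_st; apply/permP=> x.
by apply: (can_inj hK); rewrite -!relabelE eq_st.
Qed.

Lemma transitive_in_normaliser_relabel (M : {set {perm T}})
    (gT : finGroupType) (G : {group gT}) :
  transitive_in_normaliser M G ->
  transitive_in_normaliser (relabel @* M) G.
Proof.
case=> H [nMH trH isoGH]; exists (relabel @* H)%G; split.
- exact: morphim_norms.
- case/imsetP: trH => x0 _ defT; apply/imsetP; exists (h x0) => //.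
  apply/setP=> y; rewrite inE; symmetry; apply/orbitP.
  have: h' y \in orbit 'P H x0 by rewrite -defT.
  case/orbitP=> s Hs /= s_x0; exists (relabel s).
    by apply: mem_morphim; rewrite ?inE.
  by rewrite /= /aperm relabelE -[y]h'K -s_x0.
- by apply: isog_trans isoGH (sub_isog (subsetT _) injm_relabel).
Qed.

End Relabel.

(** A regular group M isomorphic to N is carried to the left regular
    representation of N by the bijection a |-> f(a^-1) x0. The inverse is
    there because products of permutations are read from left to right, so
    that a |-> f(a) x0 would give the right regular representation. *)
Lemma admissible_regular (T : finType) (M : {group {perm T}}) (x0 : T)
    (N : finGroupType) (gT : finGroupType) (G : {group gT}) :
    {in M &, injective (fun s : {perm T} => s x0)} -> #|M| = #|T| ->
    [set: N] \isog M ->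
  admissible G N <-> transitive_in_normaliser M G.
Proof.
move=> semireg oM /isogP[f inj_f fN]; pose h (a : N) := f a^-1 x0.
have Mf a : f a \in M by rewrite -fN mem_morphim ?inE.
have h_inj: injective h.
  by move=> a b /semireg/(injmP inj_f)/invg_inj->; rewrite ?inE.
have hM a b : h (a * b) = f a^-1 (h b).
  by rewrite /h invMg morphM ?inE // permM.
have [|h' hK h'K] := inj_card_bij h_inj.
  by rewrite -oM -fN card_injm ?subsetT // cardsT.
have left_transE a : relabel h'K hK (f a^-1) = Defs.left_trans a.
  by apply/permP=> b; rewrite -[b]hK relabelE hK permE -hM hK.
have left_reg_M : relabel h'K hK @* M = left_reg N.
  apply/setP=> s; apply/idP/imsetP=> [/morphimP[t _] | [a _ ->]].
    rewrite -fN => /morphimP[a _ _ ->] ->; exists a^-1; first by rewrite inE.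
    by rewrite -left_transE invgK.
  by rewrite -left_transE mem_morphim ?inE ?Mf.
split=> [adm | /(transitive_in_normaliser_relabel h'K hK)]; last first.
  by rewrite left_reg_M.
have:= @transitive_in_normaliser_relabel _ _ _ _ hK h'K (left_reg N) _ G adm.
suff -> : relabel hK h'K @* left_reg N = M by [].
have relabelK s : relabel hK h'K (relabel h'K hK s) = s.
  by apply/permP=> x; rewrite -[x in LHS]h'K !relabelE h'K.
rewrite -left_reg_M; apply/setP=> s; apply/idP/idP.
  by case/morphimP=> _ _ /morphimP[t _ Mt ->] -> /=; rewrite relabelK.
by move=> Ms; rewrite -[s]relabelK !mem_morphim ?inE.
Qed.

(** * Elements acting on p-subgroups as power maps *)

(** An invariant of the abstract group G that will recover the order of the
    character chi of a regular group normalised by G. *)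
Definition acts_by_powers (p e : nat) (gT : finGroupType) (G : {set gT}) :
    Prop :=
  forall (P : {group gT}) (g : gT),
    P \subset G -> p.-group P -> g \in G ->
  exists m : nat, {in P, forall x, x ^ (g ^+ e) = x ^+ m}.

Lemma acts_by_powers_isog (p e : nat) (gT rT : finGroupType)
    (G : {group gT}) (H : {group rT}) :
  G \isog H -> acts_by_powers p e G -> acts_by_powers p e H.
Proof.
case/isogP=> f inj_f <- powG P _ sPfG pP /morphimP[g _ Gg ->].
have sPG: f @*^-1 P \subset G by apply: subsetIl.
have pP': p.-group (f @*^-1 P).
  by rewrite -(injmK inj_f sPG) ?morphpreK -1?(morphim_pgroup f) //
             -?(injm_pgroup inj_f) ?morphpreK.
have [m powP] := powG [group of f @*^-1 P] g sPG pP' Gg.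
exists m => y Py; have /morphimP[x _ Gx def_y] := subsetP sPfG y Py.
rewrite def_y -morphX // -morphJ ?groupX // powP ?morphX //.
by rewrite mem_morphpre // -def_y.
Qed.

(** * Permutations of F_p x Y that are affine on fibres *)

Section FibredAffine.

Variables (p : nat) (Y : finType).
Local Notation F := 'F_p.
Implicit Types (d : {unit F}) (b : Y -> F) (t : {perm Y}).

Lemma fib_inj d b t :
  injective (fun w : F * Y => (val d * w.1 + b w.2, t w.2)%R : F * Y).
Proof.
move=> [v y] [v' y'] /= /pair_equal_spec[eq_v /perm_inj eq_y]; move: eq_v.
by rewrite -eq_y => /addIr/(mulrI (valP d))->.
Qed.

Definition fib d b t : {perm F * Y} := perm (@fib_inj d b t).

Lemma fibE d b t v y : fib d b t (v, y) = (val d * v + b y, t y)%R.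
Proof. by rewrite permE. Qed.

Lemma eq_fib d b b' t : b =1 b' -> fib d b t = fib d b' t.
Proof. by move=> eq_b; apply/permP=> -[v y]; rewrite !fibE eq_b. Qed.

Lemma fibM d b t d' b' t' :
  fib d b t * fib d' b' t' =
    fib (d' * d) (fun y => val d' * b y + b' (t y))%R (t * t').
Proof.
apply/permP=> -[v y]; rewrite permM !fibE permM /=.
by rewrite mulrDr mulrA addrA.
Qed.

Lemma fib1 : fib 1 (fun=> 0%R) 1 = 1.
Proof.
by apply/permP=> -[v y]; rewrite fibE !perm1 mul1r addr0.
Qed.

Lemma fib_eq (y0 : Y) d b t d' b' t' :
  fib d b t = fib d' b' t' -> [/\ d = d', b =1 b' & t = t'].
Proof.
move/permP=> eq_f; have eq_b: b =1 b'.
  by move=> y; have:= eq_f (0%R, y); rewrite !fibE !mulr0 !add0r => /pair_equal_spec[].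
split=> //; last first.
  by apply/permP=> y; have:= eq_f (0%R, y); rewrite !fibE => /pair_equal_spec[].
apply: val_inj; have:= eq_f (1%R, y0).
by rewrite !fibE !mulr1 eq_b => /pair_equal_spec[/addIr].
Qed.

Lemma fibX d b t n : exists b', fib d b t ^+ n = fib (d ^+ n) b' (t ^+ n).
Proof.
elim: n => [|n [b' IHn]]; first by exists (fun=> 0%R); rewrite fib1.
by eexists; rewrite expgSr IHn fibM -expgS -expgSr.
Qed.

Lemma shiftX b n :
  fib 1 b 1 ^+ n = fib 1 (fun y => b y *+ n)%R 1.
Proof.
elim: n => [|n IHn]; first by rewrite expg0 -fib1.
rewrite expgSr IHn fibM !mulg1; apply: eq_fib => y.
by rewrite mul1r perm1 mulrSr.
Qed.

(** The action of an element on the maps v |-> v + b(y): its linear part d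
    scales b, and its action t on the base permutes the arguments of b. *)
Lemma shiftJ b d c t :
  fib 1 b 1 ^ fib d c t = fib 1 (fun y => val d * b (t^-1%g y))%R 1.
Proof.
apply/(mulgI (fib d c t)); rewrite -conjgC !fibM !mul1g !mulg1.
apply: eq_fib => y.
by rewrite mul1r perm1 permK addrC.
Qed.

Lemma mulr_unit_nat (a : F) (v : F) : (a * v = a *+ (v : nat))%R.
Proof. by rewrite -mulr_natr natr_Zp. Qed.

End FibredAffine.

(** * Fibred regular groups and their normalisers *)

Lemma prime_coprime_fact (p n : nat) : prime p -> n < p -> coprime p n`!.
Proof.
move=> p_pr; elim: n => [|n IHn] lt_np; first by rewrite coprimen1.
by rewrite factS coprimeMr IHn 1?ltnW // andbT prime_coprime // gtnNdvd.
Qed.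

Lemma unit_mulC (R : finComUnitRingType) (u w : {unit R}) : u * w = w * u.
Proof. by apply: val_inj; apply: mulrC. Qed.

Section FibredRegular.

Variables (p : nat) (Y : finType) (y0 : Y).
Local Notation F := 'F_p.
Variables (chi : Y -> {unit F}) (tau : Y -> {perm Y}).
Hypotheses (p_pr : prime p) (ltYp : #|Y| < p).
Hypotheses (tau0 : forall z, tau z y0 = z).
Hypothesis tauM : forall z w, tau z * tau w = tau (tau w z).
Hypothesis chiM : forall z w, chi (tau w z) = chi w * chi z.

(** Both {unit F_p}, of order p - 1, and the symmetric group of a set with
    fewer than p elements have order prime to p. *)
Lemma p_elt_fib (d : {unit F}) (b : Y -> F) (t : {perm Y}) :
  p.-elt (fib d b t) -> d = 1 /\ t = 1.
Proof.
move=> p_f; have [b' fX] := fibX d b t #[fib d b t].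
move: fX; rewrite expg_order -fib1 => /(fib_eq y0)[/esym d1 _ /esym t1].
have dvd1 (aT : finGroupType) (x : aT) :
  x ^+ #[fib d b t] = 1 -> coprime p #|[set: aT]| -> x = 1.
  move=> /eqP; rewrite -order_dvdn => /pnat_dvd/(_ p_f) p_x co_p.
  have p'x: p^'.-nat #[x].
    by rewrite p'natE // -prime_coprime // (coprime_dvdr _ co_p) ?order_dvdG ?inE.
  by apply/eqP; rewrite -order_eq1 (pnat_1 p_x p'x).
split.
  apply: dvd1 d1 _; rewrite card_finField_unit card_Fp //.
  by case: p p_pr => [|[|n]] // n_pr; rewrite prime_coprime // gtnNdvd.
apply: dvd1 t1 _; have: [set: {perm Y}] = [set s | perm_on [set: Y] s].
  by apply/setP=> s; rewrite !inE; apply/esym/subsetP=> y; rewrite inE.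
by move=> ->; rewrite cardsE card_perm cardsT prime_coprime_fact.
Qed.

(** For tau_z the left translations of a group structure on Y and chi a
    character of it, these are the left translations of the semidirect product
    of F_p by Y. *)
Definition freg (w : F * Y) : {perm F * Y} :=
  fib (chi w.2) (fun=> w.1) (tau w.2).

Definition fibred_regular : {set {perm F * Y}} := [set freg w | w : F * Y].

Lemma fregE w : freg w (0%R, y0) = w.
Proof. by case: w => c z; rewrite fibE mulr0 add0r tau0. Qed.

Lemma fregM w w' :
  freg w * freg w' = freg (val (chi w'.2) * w.1 + w'.1, tau w'.2 w.2)%R.
Proof. by rewrite fibM tauM -chiM; apply: eq_fib. Qed.

Lemma tau1 : tau y0 = 1.
Proof. by apply/(mulgI (tau y0)); rewrite tauM tau0 mulg1. Qed.

Lemma chi1 : chi y0 = 1.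
Proof. by apply/(mulgI (chi y0)); rewrite -chiM tau0 mulg1. Qed.

Lemma shift_freg c : fib 1 (fun=> c) 1 = freg (c, y0).
Proof. by rewrite /freg /= tau1 chi1. Qed.

Lemma fibred_regular_group_set : group_set fibred_regular.
Proof.
apply/group_setP; split=> [|_ _ /imsetP[w _ ->] /imsetP[w' _ ->]].
  by apply/imsetP; exists (0%R, y0); rewrite // -shift_freg fib1.
by rewrite fregM imset_f.
Qed.
Canonical fibred_regular_group := Group fibred_regular_group_set.

Lemma freg_semiregular :
  {in fibred_regular &, injective (fun s : {perm F * Y} => s (0%R, y0))}.
Proof. by move=> _ _ /imsetP[w _ ->] /imsetP[w' _ ->]; rewrite !fregE => ->. Qed.

Lemma card_fibred_regular : #|fibred_regular| = #|{: F * Y}|.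
Proof. by rewrite card_imset // => w w' eq_w; rewrite -[w]fregE eq_w fregE. Qed.


(** The translation v |-> v + 1 must be sent to an element of order p, that is
    to some v |-> v + d, which makes f affine on fibres with constant slope d.
    As the slopes of m and m^f agree, chi(t z) = chi(t 0) chi(z). Comparing
    constant terms shows that b - b(0) is a crossed homomorphism with values
    in F_p; summing its defining relation over Y, whose order is prime to p,
    shows that it is principal, so that b is an affine function of chi. *)
Lemma normaliser_fibred_regular f : f \in 'N(fibred_regular) ->
  exists d b t, [/\ f = fib d b t,
    forall z, chi (t z) = chi (t y0) * chi z,
    exists u c, forall y, (b y = u * val (chi y) + c)%R
  & forall z, exists z', forall y, t (tau z y) = tau z' (t y)].
Proof.
move=> nMf; have freg_M w : freg w \in fibred_regular by apply: imset_f.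
have fregJ w : exists w', freg w * f = f * freg w'.
  have /imsetP[w' _ e_w']: freg w ^ f \in fibred_regular by rewrite memJ_norm.
  by exists w'; rewrite -e_w' -conjgC.
have [c f1]: exists c, fib 1 (fun=> 1%R) 1 * f = f * fib 1 (fun=> c) 1.
  have /imsetP[w' _ def_w']: fib 1 (fun=> 1%R) 1 ^ f \in fibred_regular.
    by rewrite memJ_norm // shift_freg.
  have p_e : p.-elt (fib 1 (fun=> 1%R) 1 : {perm F * Y}).
    apply: (@pnat_dvd _ p); last exact: pnat_id.
    rewrite order_dvdn shiftX -fib1; apply/eqP/eq_fib => y.
    by rewrite -mulr_natr pchar_Fp_0 ?mulr0.
  have:= p_e; rewrite -(p_eltJ _ _ f) def_w' => /p_elt_fib[chi_w' tau_w'].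
  exists w'.1; rewrite conjgC def_w' /freg chi_w' tau_w'.
  by [].
have f1E v y : f (v + 1, y)%R = ((f (v, y)).1 + c, (f (v, y)).2)%R.
  have:= congr1 (fun s : {perm _} => s (v, y)) f1.
  rewrite !permM fibE perm1 mul1r => ->.
  by case: (f _) => a z; rewrite fibE mul1r perm1.
have fE v y : f (v, y) = (c * v + (f (0, y)).1, (f (0, y)).2)%R.
  rewrite mulr_unit_nat -{1}[v]natr_Zp; elim: (v : nat) => [|n IHn].
    by rewrite add0r; case: (f _).
  by rewrite mulrSr f1E IHn /= mulrSr addrAC.
have c_unit: c \is a GRing.unit.
  rewrite unitfE; apply/eqP=> c0; have := fE 1%R y0; rewrite c0 mul0r add0r.
  rewrite -surjective_pairing => /perm_inj/pair_equal_spec[/eqP].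
  by rewrite oner_eq0.
have t_inj: injective (fun y => (f (0%R, y)).2).
  move=> y y' eq_t; have := fE (c^-1 * ((f (0, y')).1 - (f (0, y)).1))%R y.
  rewrite mulVKr // subrK eq_t -surjective_pairing.
  by move/perm_inj/pair_equal_spec=> [].
pose d : {unit F} := FinRing.unit F c_unit.
pose b y := (f (0%R, y)).1; pose t := perm t_inj.
have def_f : f = fib d b t.
  by apply/permP=> -[v y]; rewrite fibE fE permE.
have comm_f z : exists c' z', [/\ chi z = chi z',
    forall y, (b (tau z y) = val (chi z) * b y + c')%R
  & forall y, t (tau z y) = tau z' (t y)].
  have [[c' z']] := fregJ (0%R, z); rewrite def_f !fibM /=.
  case/(fib_eq y0) => eq_chi eq_b eq_t; exists c', z'.
  have {}eq_chi : chi z = chi z' by apply: (mulgI d); rewrite eq_chi unit_mulC.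
  split=> // y; last by rewrite -!permM eq_t.
  by have := eq_b y; rewrite mulr0 add0r eq_chi.
exists d, b, t; split=> // [z||z];
  last by have [c' [z' [_ _ eq_t]]] := comm_f z; exists z'.
  have [c' [z' [-> _ eq_t]]] := comm_f z.
  by rewrite -{1}[z]tau0 eq_t chiM unit_mulC.
(* g is a crossed homomorphism for the group structure on Y; S sums it. *)
pose g y := (b y - b y0)%R; pose S := (\sum_y g y)%R.
have gM z y : (g (tau z y) = val (chi z) * g y + g z)%R.
  have [c' [z' [_ eq_b _]]] := comm_f z.
  have := eq_b y0; rewrite tau0 => b_z; rewrite /g eq_b b_z.
  by ring.
have eq_S z : (S = val (chi z) * S + g z *+ #|Y|)%R.
  rewrite {1}/S (reindex_inj (@perm_inj _ (tau z))) /=.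
  rewrite (eq_bigr _ (fun y _ => gM z y)).
  by rewrite big_split /= -mulr_sumr sumr_const.
have nzY : (#|Y|%:R != 0 :> F)%R.
  have Y_gt0: 0 < #|Y| by apply/card_gt0P; exists y0.
  by rewrite -(dvdn_pcharf (pchar_Fp p_pr)) gtnNdvd.
exists (- (S / #|Y|%:R))%R, (b y0 + S / #|Y|%:R)%R => z.
have: (g z * #|Y|%:R = S - val (chi z) * S)%R.
  by rewrite mulr_natr {1}(eq_S z) addrC addKr.
move/(canRL (mulfK nzY)); rewrite /g => /(canRL (subrK _))->.
by ring.
Qed.

Lemma chi_iter (t : {perm Y}) :
    (forall z, chi (t z) = chi (t y0) * chi z) ->
  forall e y, chi ((t ^+ e) y) = chi (t y0) ^+ e * chi y.
Proof.
move=> chi_t; elim=> [|e IHe] y; first by rewrite perm1 mul1g.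
by rewrite expgSr permM chi_t IHe mulgA expgS.
Qed.

Lemma p_elt_normaliser f : f \in 'N(fibred_regular) -> p.-elt f ->
  exists u c, f = fib 1 (fun y => u * val (chi y) + c)%R 1.
Proof.
case/normaliser_fibred_regular=> d [b [t [-> _ [u [c eq_b]] _]]].
by case/p_elt_fib=> -> ->; exists u, c; apply: eq_fib.
Qed.

(** Conjugation by an element (d, b, t) sends u chi + c to d (u chi(t 0)^-1
    chi + c), and its e-th power therefore acts as the scalar d^e as soon as
    chi^e = 1. *)
Lemma normaliser_acts_by_powers (H : {group {perm F * Y}}) e :
    H \subset 'N(fibred_regular) -> (forall z, chi z ^+ e = 1) ->
  acts_by_powers p e H.
Proof.
move=> nMH chi_e P g sPH pP /(subsetP nMH).
case/normaliser_fibred_regular=> d [b [t [-> chi_t _ _]]].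
have [b' ->] := fibX d b t e.
exists (val (d ^+ e) : F) => x Px.
have [] := p_elt_normaliser (subsetP nMH _ (subsetP sPH _ Px)) (mem_p_elt pP Px).
move=> u [c ->]; rewrite shiftJ shiftX; apply: eq_fib => y.
rewrite -mulr_unit_nat [RHS]mulrC; congr (_ * (_ * val _ + _))%R.
by rewrite -{2}[y](permKV (t ^+ e)) chi_iter // chi_e mul1g.
Qed.

(** If chi(z) is not 1, a Sylow p-subgroup of H is as large as possible: it
    contains the maps v |-> v + u chi(y) + c for all u and c. Take the one
    with u = c = 1, and an element of H moving 0 to z in the base: if its e-th
    power acts as a power map, its two eigenvalues d^e and d^e chi(z)^-e are
    equal. *)
Lemma acts_by_powers_chi (H : {group {perm F * Y}}) e :
    H \subset 'N(fibred_regular) -> [transitive H, on [set: F * Y] | 'P] ->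
    p ^ 2 %| #|H| -> acts_by_powers p e H ->
  forall z, chi z ^+ e = 1.
Proof.
move=> nMH trH p2H powH z; have [->|nt_chi] := eqVneq (chi z) 1.
  by rewrite expg1n.
have [P sylP] := Sylow_exists p H; have [sPH pP _] := and3P sylP.
pose x : {perm F * Y} := fib 1 (fun y => 1 * val (chi y) + 1)%R 1.
have Px: x \in P.
  pose S := [set fib 1 (fun y => w.1 * val (chi y) + w.2)%R 1
              | w : F * F] : {set {perm F * Y}}.
  have sPS: P \subset S.
    apply/subsetP=> s Ps; apply/imsetP.
    have [] := p_elt_normaliser (subsetP nMH _ (subsetP sPH _ Ps)) (mem_p_elt pP Ps).
    by move=> u [c ->]; exists (u, c).
  suff /eqP->: P == S :> {set _} by apply/imsetP; exists (1, 1)%R.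
  rewrite eqEcard sPS (leq_trans (leq_imset_card _ _)) // card_prod card_Fp //.
  rewrite (card_Hall sylP) p_part mulnn (leq_exp2l _ _ (prime_gt1 p_pr)).
  by rewrite -pfactor_dvdn ?cardG_gt0.
have [g Hg /= gz] := atransP2 trH (in_setT (0%R, y0)) (in_setT (0%R, z)).
have [m powP] := powH P g sPH pP Hg; move: gz (powP x Px).
case/normaliser_fibred_regular: (subsetP nMH g Hg) => d [b [t [-> chi_t _ _]]].
rewrite /= /aperm fibE => /pair_equal_spec[_ def_z].
have [b' ->] := fibX d b t e.
rewrite shiftJ shiftX => /(fib_eq y0)[_ eq_x _].
set D : F := val (d ^+ e); set W : F := val (chi z ^+ e).
(* D and D / W are the two eigenvalues of g ^+ e. *)
have eqD y : (D * (val (chi y) + 1) = m%:R * (W * val (chi y) + 1))%R.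
  have:= eq_x ((t ^+ e) y); rewrite permK chi_iter // !mul1r -def_z => ->.
  by rewrite mulr_natl.
have nz_D : (D != 0)%R by rewrite -unitfE (valP (d ^+ e)).
have eq_z := eqD z; have eq_1 : (D * (1 + 1) = m%:R * (W * 1 + 1))%R.
  by have:= eqD y0; rewrite chi1.
move: (m%:R)%R eq_z eq_1 => m' eq_z eq_1.
have def_mW: (D = m' * W)%R.
  apply: (@mulIf _ (val (chi z) - 1)%R); first by rewrite subr_eq0.
  have -> : (D * (val (chi z) - 1) = D * (val (chi z) + 1) - D * (1 + 1))%R.
    by ring.
  by rewrite eq_z eq_1; ring.
have eq_mD : (m' = D)%R.
  apply: (addrI D); move: eq_1; rewrite mulrDr !mulr1 => ->.
  by rewrite {1}def_mW; ring.
apply: val_inj; change (W = 1)%R; apply: (mulfI nz_D).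
by rewrite -{1}eq_mD -def_mW mulr1.
Qed.

End FibredRegular.

(** * Translations on Z/n, and the holomorph in the cyclic case *)

Section Translations.

Variables (p n : nat).
Hypotheses (p_pr : prime p) (n_gt1 : 1 < n).
Local Notation F := 'F_p.
Local Notation Z := 'Z_n.

Definition tr (z : Z) : {perm Z} := perm (@addIr Z z).

Lemma trE z y : tr z y = (y + z)%R.
Proof. by rewrite permE. Qed.

Lemma tr0 z : tr z 0%R = z.
Proof. by rewrite trE add0r. Qed.

Lemma tr_0 : tr 0%R = 1.
Proof. by apply/permP=> y; rewrite perm1 trE addr0. Qed.

Lemma trM z w : tr z * tr w = tr (tr w z).
Proof. by apply/permP=> y; rewrite permM !trE addrA. Qed.

Lemma trC z w : tr z * tr w = tr w * tr z.
Proof. by apply/permP=> y; rewrite !permM !trE addrAC. Qed.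

Lemma tr_inj : injective tr.
Proof. by move=> z w eq_zw; rewrite -[z]tr0 eq_zw tr0. Qed.

Lemma card_Zn : #|{: Z}| = n.
Proof. by rewrite card_ord Zp_cast. Qed.

Lemma expg_ZnD (gT : finGroupType) (w : gT) (y z : Z) :
  w ^+ n = 1 -> w ^+ (y + z : Z)%R = w ^+ y * w ^+ z.
Proof. rewrite -expgD -{1}(Zp_cast n_gt1) => wn; exact: expg_mod wn. Qed.

Lemma chi_tr (w : {unit F}) : w ^+ n = 1 ->
  forall z y : Z, w ^+ tr y z = w ^+ y * w ^+ z.
Proof. by move=> wn z y; rewrite trE addrC expg_ZnD. Qed.

Definition aff_tr (a : {unit F} * F * Z) : {perm F * Z} :=
  fib a.1.1 (fun=> a.1.2) (tr a.2).

(** The group W = Hol(F_p) x Z/n, which normalises each of the regular groups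
    used below. *)
Definition affine_translations : {set {perm F * Z}} :=
  [set aff_tr a | a : {unit F} * F * Z].

Lemma affine_translations_group_set : group_set affine_translations.
Proof.
apply/group_setP; split=> [|_ _ /imsetP[a _ ->] /imsetP[a' _ ->]].
  apply/imsetP; exists (1, 0%R, 0%R) => //.
  by rewrite -fib1 -tr_0.
by rewrite fibM trM; apply/imsetP; eexists (_, _, _) => //.
Qed.
Canonical affine_translations_group := Group affine_translations_group_set.

(** The affine part of W only changes the constant terms of an element of
    [fibred_regular chi tau], so that the translations of the base are the
    only obstruction. *)
Lemma affine_translations_norm (chi : Z -> {unit F}) (tau : Z -> {perm Z}) :
    (forall w z, exists2 z', tau z * tr w = tr w * tau z' & chi z = chi z') ->
  affine_translations \subset 'N(fibred_regular chi tau).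
Proof.
move=> tauJ; apply/subsetP=> _ /imsetP[[[d c] w] _ ->]; rewrite inE.
apply/subsetP=> _ /imsetP[_ /imsetP[[c' z] _ ->] ->]; apply/imsetP => /=.
have [z' eq_t eq_chi] := tauJ w z.
exists ((val d * c' + c - val (chi z') * c)%R, z') => //.
apply: (mulgI (aff_tr (d, c, w))); rewrite -conjgC !fibM /= eq_t eq_chi unit_mulC.
by apply: eq_fib => y /=; ring.
Qed.

End Translations.

Section CyclicHolomorph.

Variables (p q : nat).
Hypotheses (p_pr : prime p) (q_odd : odd q) (q_gt1 : 1 < q).
Hypothesis n_lt_p : 2 * q < p.
Local Notation F := 'F_p.
Local Notation Z := 'Z_(2 * q).
Variable w : {unit F}.
Hypotheses (w2q : w ^+ (2 * q) = 1) (q_w : q %| #[w]).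

Lemma twoq_gt1 : 1 < 2 * q.
Proof. by rewrite mul2n -addnn (leq_trans q_gt1) ?leq_addr. Qed.
Local Notation n_gt1 := twoq_gt1.

Local Notation chi := (fun z : Z => w ^+ z).
Local Notation M := (fibred_regular chi (@tr (2 * q))).

(** The holomorph of the semidirect product of F_p by Z/2q, with a generator
    of Z/2q acting on F_p as w: the two constants u and c are the parameters
    of the right and of the left translations by elements of F_p. *)
Definition hol_elt (a : {unit F} * (F * F) * Z) : {perm F * Z} :=
  fib a.1.1 (fun y : Z => a.1.2.1 * val (w ^+ y)%g + a.1.2.2)%R (tr a.2).

Definition hol : {set {perm F * Z}} :=
  [set hol_elt a | a : {unit F} * (F * F) * Z].

Lemma w_neq1 : w != 1.
Proof.
apply: contraL q_w => /eqP->; rewrite order1 gtnNdvd //.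
Qed.

Lemma odd_Zn_unit (a y : Z) : (y * a = 1)%R -> odd a.
Proof.
have odd_mod2 m : odd (m %% (Zp_trunc (2 * q)).+2) = odd m.
  by rewrite odd_mod // Zp_cast ?n_gt1 // oddM.
by move/(congr1 (fun z : Z => odd z)); rewrite /= !odd_mod2 oddM => /andP[].
Qed.

Lemma Zn_lt_p : #|{: Z}| < p.
Proof. by rewrite card_Zn ?n_gt1. Qed.

(** The permutation t - t(0) is additive, hence multiplication by some unit a
    of Z/2q, with w^a = w. So a is 1 modulo q since q divides the order of w,
    and it is odd since it is a unit modulo 2q; therefore a = 1. *)
Lemma normaliser_sub_hol : 'N(M) \subset hol.
Proof.
apply/subsetP=> f.
have chiM := chi_tr n_gt1 w2q.
case/(normaliser_fibred_regular p_pr Zn_lt_p (@tr0 _) (@trM _) chiM).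
move=> d [b [t [-> chi_t [u [c eq_b]] tauJ]]].
pose a : Z := (t 1 - t 0)%R.
have t1 y : t (y + 1)%R = (t y + a)%R.
  have [z'] := tauJ 1%R => tz; have:= tz y; have := tz 0%R.
  by rewrite !trE add0r /a => -> ->; ring.
have tE y : t y = (y * a + t 0)%R.
  have tm m : t (m%:R)%R = (a *+ m + t 0)%R.
    elim: m => [|m IHm]; first by rewrite add0r.
    by rewrite mulrSr t1 IHm mulrSr addrAC.
  by rewrite -{1}[y]natr_Zp tm -mulr_natl natr_Zp.
have chi_a: w ^+ a = w.
  apply: (mulgI (w ^+ t 0%R)); rewrite -expg_ZnD ?n_gt1 // /a addrC subrK.
  by rewrite (chi_t 1%R).
have a_odd : odd a.
  apply: (@odd_Zn_unit _ (t^-1 (1 + t 0)%R)).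
  by have := tE (t^-1%g (1 + t 0)%R); rewrite permKV => /addIr.
have a1 : a = 1%R.
  apply: val_inj; change (nat_of_ord a = 1%N); have: nat_of_ord a = 1 %[mod 2 * q].
    apply/eqP; rewrite chinese_remainder ?coprime2n // !modn2 a_odd eqxx /=.
    have/eqP := chi_a; rewrite -{2}[w]expg1 eq_expg_mod_order => /eqP eq_a.
    by rewrite -(modn_dvdm a q_w) eq_a modn_dvdm.
  by rewrite !modn_small ?twoq_gt1 // (leq_trans (ltn_ord a)) // Zp_cast ?twoq_gt1.
apply/imsetP; exists (d, (u, c), t 0%R); rewrite ?inE // /hol_elt /=.
have -> : tr (t 0%R) = t by apply/permP=> y; rewrite trE [RHS]tE a1 mulr1.
exact: eq_fib.
Qed.

Lemma hol_elt_inj : injective hol_elt.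
Proof.
move=> [[d [u c]] z] [[d' [u' c']] z'] /(fib_eq 0%R)[/= -> eq_b /tr_inj->].
have eq0 : (u * 1 + c = u' * 1 + c')%R := eq_b 0%R.
have eq1 : (u * val w + c = u' * val w + c')%R := eq_b 1%R.
have nz : (val w - 1 != 0 :> F)%R by rewrite subr_eq0; exact: w_neq1.
have eq_u: u = u'.
  apply: (mulIf nz).
  have -> : (u * (val w - 1) = (u * val w + c) - (u * 1 + c))%R by ring.
  by rewrite eq1 eq0; ring.
by move: eq0; rewrite eq_u => /addrI->.
Qed.

Lemma card_hol : #|hol| = (2 * p ^ 2 * q * p.-1)%N.
Proof.
rewrite card_imset; last exact: hol_elt_inj.
have oU : #|{: {unit F}}| = p.-1 by rewrite -cardsT card_finField_unit card_Fp.
have oF : #|{: F}| = p := card_Fp p_pr.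
rewrite !card_prod oU oF card_Zn ?twoq_gt1 //.
ring.
Qed.

Lemma hol_eltM a a' : exists b : F * F,
  hol_elt a * hol_elt a' = hol_elt (a'.1.1 * a.1.1, b, (a.2 + a'.2)%R).
Proof.
case: a a' => [[d [u c]] z] [[d' [u' c']] z'] /=.
exists (val d' * u + u' * val (w ^+ z)%g, val d' * c + c')%R.
rewrite fibM trM trE; apply: eq_fib => y /=.
by rewrite trE expg_ZnD ?twoq_gt1 //=; ring.
Qed.

Lemma hol_elt1 : hol_elt (1, (0%R, 0%R), 0%R) = 1.
Proof.
rewrite -fib1 /hol_elt /= tr_0.
by apply: eq_fib => y; rewrite /= mul0r addr0.
Qed.

Lemma hol_group_set : group_set hol.
Proof.
apply/group_setP; split=> [|_ _ /imsetP[a _ ->] /imsetP[a' _ ->]].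
  by apply/imsetP; exists (1, (0%R, 0%R), 0%R); rewrite ?hol_elt1.
by have [b ->] := hol_eltM a a'; apply: imset_f.
Qed.
Canonical hol_group := Group hol_group_set.

Lemma card_sub_hol (H : {group {perm F * Z}}) :
  H \subset hol -> #|H| %| 2 * p ^ 2 * q * p.-1.
Proof. by rewrite -card_hol; apply: (@cardSg _ hol_group H). Qed.

Definition hol_p : {set {perm F * Z}} := [set hol_elt (1, b, 0%R) | b : F * F].
Definition hol_p' : {set {perm F * Z}} :=
  [set hol_elt (a.1, (0%R, 0%R), a.2) | a : {unit F} * Z].

Lemma hol_p_group_set : group_set hol_p.
Proof.
apply/group_setP; split=> [|_ _ /imsetP[b _ ->] /imsetP[b' _ ->]].
  by apply/imsetP; exists (0%R, 0%R); rewrite ?hol_elt1.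
have [b'' ->] := hol_eltM (1, b, 0%R) (1, b', 0%R).
by apply/imsetP; exists b''; rewrite ?mulg1 ?addr0.
Qed.
Canonical hol_p_group := Group hol_p_group_set.

(** Slope and translation part are multiplicative on [hol], with common kernel
    [hol_p]. Stated for the quotient of two elements, this spares a projection
    of [hol] to {unit F} x Z. *)
Lemma mem_hol_p (f x g : {perm F * Z}) (a a' : {unit F} * (F * F) * Z) :
    x \in hol -> f * x = g -> f = hol_elt a -> g = hol_elt a' ->
  a.1.1 = a'.1.1 -> a.2 = a'.2 -> x \in hol_p.
Proof.
move=> /imsetP[[[d b] z] _ ->] eq_g def_f def_g; move: eq_g.
rewrite def_f def_g; have [b' ->] := hol_eltM a (d, b, z).
case: a a' {def_f def_g} => [[d1 b1] z1] [[d2 b2] z2] /= /hol_elt_inj/pair_equal_spec[].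
move=> /pair_equal_spec[dE _] zE d12 z12; apply/imsetP; exists b => //.
congr (hol_elt (_, _, _)); first by apply: (mulIg d1); rewrite dE mul1g.
by apply: (addrI z1); rewrite zE addr0.
Qed.

Lemma hol_p_normal : hol_p <| hol.
Proof.
apply/andP; split; apply/subsetP=> x.
  by case/imsetP=> b _ ->; apply: imset_f.
move=> hx; rewrite inE; apply/subsetP=> _ /imsetP[y Py ->].
have hy : y \in hol by case/imsetP: Py => b _ ->; apply: imset_f.
have hyx : y ^ x \in hol_group by rewrite groupJ.
case/imsetP: hx hyx => a _ ->; case/imsetP: Py hy => b _ -> hy hyx.
have [b' eM] := hol_eltM (1, b, 0%R) a.
apply: (mem_hol_p hyx (esym (conjgC _ _)) erefl eM); rewrite /= ?mulg1 //.
by rewrite add0r.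
Qed.

Lemma hol_p_abelian : abelian hol_p.
Proof.
apply/subsetP=> _ /imsetP[[u c] _ ->]; apply/centP=> _ /imsetP[[u' c'] _ ->].
rewrite /commute !fibM trC; apply: eq_fib => y.
by rewrite /= !trE !addr0; ring.
Qed.

(** It is metabelian: slopes and translation parts commute. *)
Lemma hol_solvable : solvable hol.
Proof.
rewrite (series_sol hol_p_normal) abelian_sol ?hol_p_abelian //=.
apply/abelian_sol/sub_der1_abelian; rewrite gen_subG.
apply/subsetP=> _ /imset2P[x y hx hy ->].
have hR : [~ x, y] \in hol_group by rewrite groupR.
have eR : (y * x) * [~ x, y] = x * y by apply/esym/commgC.
case/imsetP: hx eR hR => a _ ->; case/imsetP: hy => a' _ -> eR hR.
have [b eM] := hol_eltM a a'; have [b' eM'] := hol_eltM a' a.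
by apply: (mem_hol_p hR eR eM' eM); [apply: unit_mulC | apply: addrC].
Qed.

Lemma hol_p'_group_set : group_set hol_p'.
Proof.
apply/group_setP; split=> [|_ _ /imsetP[a _ ->] /imsetP[a' _ ->]].
  by apply/imsetP; exists (1, 0%R); rewrite ?hol_elt1.
apply/imsetP; exists (a'.1 * a.1, (a.2 + a'.2)%R) => //.
rewrite fibM trM trE; apply: eq_fib => y /=.
by rewrite !mul0r !addr0 mulr0.
Qed.
Canonical hol_p'_group := Group hol_p'_group_set.

Lemma hol_p'_Hall : p^'.-Hall(hol) hol_p'.
Proof.
have s_hol : hol_p' \subset hol by apply/subsetP=> _ /imsetP[a _ ->]; apply: imset_f.
have oT : #|hol_p'| = (p.-1 * (2 * q))%N.
  rewrite card_imset => [|[d z] [d' z'] /hol_elt_inj[/= -> ->] //].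
  by rewrite card_prod -cardsT card_finField_unit card_Fp // card_Zn ?twoq_gt1.
rewrite /pHall s_hol -divgS //= card_hol /pgroup oT pnatNK.
have q_gt0 := ltnW q_gt1.
have -> : (2 * p ^ 2 * q * p.-1 = p ^ 2 * (p.-1 * (2 * q)))%N by ring.
have p1_gt0 : 0 < p.-1 by rewrite -ltnS prednK ?prime_gt0 ?prime_gt1.
rewrite mulnK ?muln_gt0 ?p1_gt0 //= pnatX pnat_id ?orbT // andbT.
rewrite pnatM !p'natE // !gtnNdvd ?muln_gt0 //.
by rewrite prednK // prime_gt0.
Qed.

(** Up to the sign of v, this map is inversion in the semidirect product. *)
Lemma hol_inversion_inj :
  injective (fun x : F * Z => (val (w ^+ (- x.2 : Z)%R)%g * x.1, - x.2)%R : F * Z).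
Proof.
move=> [v y] [v' y'] /= /pair_equal_spec[eq_v /oppr_inj eq_y]; move: eq_v.
by rewrite eq_y => /(mulrI (valP _))->.
Qed.

Definition hol_inversion : {perm F * Z} := perm hol_inversion_inj.

Lemma hol_inversionE v y :
  hol_inversion (v, y) = (val (w ^+ (- y : Z)%R)%g * v, - y)%R.
Proof. by rewrite permE. Qed.

(** Inversion exchanges the two kinds of translations, hence the constants u
    and c, up to a power of w. *)
Lemma hol_inversionJ d u (z : Z) :
  hol_elt (d, (u, 0%R), z) ^ hol_inversion \in affine_translations p (2 * q).
Proof.
pose chiF (y : Z) : F := val (w ^+ y).
have chiD y y' : (chiF (y + y') = chiF y * chiF y')%R.
  by rewrite /chiF expg_ZnD ?twoq_gt1.
have chiN y : (chiF y * chiF (- y) = 1)%R by rewrite -chiD subrr.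
apply/imsetP; exists (w ^+ (- z : Z)%R * d, (u * chiF (- z))%R, (- z)%R) => //.
apply: (mulgI hol_inversion); rewrite -conjgC; apply/permP=> -[v y].
rewrite !permM hol_inversionE !fibE hol_inversionE !trE.
apply/pair_equal_spec; split; last by rewrite opprD.
transitivity (chiF (- (y + z)) * (val d * v + (u * chiF y + 0)))%R; first by [].
transitivity (chiF (- z) * val d * (chiF (- y) * v) + u * chiF (- z))%R => //.
rewrite opprD chiD -[(u * chiF (- z))%R]mulr1 -(chiN y).
ring.
Qed.

Lemma transitive_conj (T : finType) (H : {group {perm T}}) (x : {perm T}) :
  [transitive H, on [set: T] | 'P] -> [transitive H :^ x, on [set: T] | 'P].
Proof.
case/imsetP=> y _ defT; apply/imsetP; exists (x y) => //.
apply/setP=> z; rewrite inE; apply/esym.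
have := orbit_conjsg 'P H x y (x^-1 z); rewrite /= /aperm permKV => ->.
by rewrite -defT inE.
Qed.

(** A p-complement A of H can be moved by Hall's theorem into the maps without
    constants. A Sylow p-subgroup L of the conjugate of H is normalised by it,
    and transitivity provides an element of A with translation part 1; its
    eigenvalues on the two kinds of translations differ by the factor w, which
    is not 1. As L has order at most p it consists of translations of one kind
    only. If these are the constant ones, H is already in W; otherwise
    [hol_inversion] takes it there. *)
Lemma transitive_hol_conj (H : {group {perm F * Z}}) :
    H \subset hol -> [transitive H, on [set: F * Z] | 'P] ->
    ~~ (p ^ 2 %| #|H|) ->
  exists x : {perm F * Z}, H :^ x \subset affine_translations p (2 * q).
Proof.
move=> sHhol trH p2'H.
have [A hallA] := Hall_exists p^' (solvableS sHhol hol_solvable).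
have [sAH p'A _] := and3P hallA.
have [x hx sAT] := Hall_Jsub hol_solvable hol_p'_Hall (subset_trans sAH sHhol) p'A.
have sKhol : H :^ x \subset hol by rewrite -(conjGid hx) conjSg.
have trK := transitive_conj x trH.
have [L sylL] := Sylow_exists p (H :^ x)%G; have [sLK pL _] := and3P sylL.
have hallAx : p^'.-Hall(H :^ x) (A :^ x) by rewrite pHallJ2.
have defK : L * (A :^ x) = H :^ x.
  apply/eqP; rewrite eqEcard mul_subG ?(pHall_sub hallAx) //=.
  rewrite coprime_cardMg; last by rewrite (pnat_coprime pL (pHall_pgroup hallAx)).
  by rewrite (card_Hall sylL) (card_Hall hallAx) partnC // cardG_gt0.
have sLP : L \subset hol_p.
  apply/subsetP=> l Ll; have := mem_p_elt pL Ll.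
  have /imsetP[[[d b] z] _ ->] := subsetP (subset_trans sLK sKhol) l Ll.
  case/(p_elt_fib 0%R p_pr Zn_lt_p) => /= -> z1; apply/imsetP; exists b => //.
  by congr (hol_elt (_, _, _)); apply: tr_inj; rewrite z1 tr_0.
have defL : hol_p :&: H :^ x = L.
  apply: (sub_pHall sylL); rewrite ?subsetIr // ?subsetI ?sLP //.
  rewrite /pgroup (pnat_dvd (cardSg (subsetIl _ _))) // card_imset.
    by rewrite card_prod card_Fp // mulnn pnatX pnat_id.
  by move=> b b' /hol_elt_inj/pair_equal_spec[/pair_equal_spec[]].
have aff0 d c z : hol_elt (d, (0%R, c), z) \in affine_translations p (2 * q).
  apply/imsetP; exists (d, c, z) => //; apply: eq_fib => y.
  by rewrite /= mul0r add0r.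
(* Does L contain an element that is not a constant translation? *)
have [l | L_const] := pickP [pred l | (l \in L)
   && [exists b : F * F, (l == hol_elt (1, b, 0%R)) && (b.1 != 0%R)]]; last first.
  exists x; rewrite -defK; apply: (@mul_subG _ (affine_translations_group p _)).
    apply/subsetP=> l Ll; have /imsetP[[u c] _ def_l] := subsetP sLP l Ll.
    have := L_const l; rewrite /= Ll /= => /existsP; rewrite def_l.
    have [-> // | nz_u []] := eqVneq u 0%R.
    by exists (u, c); rewrite eqxx.
  apply: subset_trans sAT _; apply/subsetP=> _ /imsetP[a _ ->]; exact: aff0.
case/andP=> Ll /existsP[[u c] /andP[/eqP def_l /= nz_u]].
have lX m : l ^+ m = hol_elt (1, (u *+ m, c *+ m)%R, 0%R).
  rewrite def_l /hol_elt /= tr_0 shiftX; apply: eq_fib => y.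
  by rewrite mulrnDl mulrnAl.
have def_L : L :=: <[l]>.
  apply/eqP; rewrite eq_sym eqEcard cycle_subG Ll /=.
  have l_neq1 : l != 1.
    apply: contraNneq nz_u => l1; have := lX 1%N; rewrite l1 expg1n -hol_elt1.
    move/hol_elt_inj/pair_equal_spec=> -[/pair_equal_spec[_] + _].
    by case/pair_equal_spec=> u0 _; rewrite -[u]mulr1n -u0.
  have [n oL] := p_natP pL; rewrite oL.
  have : ~~ (p ^ 2 %| #|L|).
    apply: contra p2'H => /dvdn_trans; apply.
    by rewrite -(cardJg H x) cardSg.
  rewrite oL (dvdn_Pexp2l _ _ (prime_gt1 p_pr)) -ltnNge => n_le1.
  apply: leq_trans (_ : p <= _).
    by rewrite -{2}[p]expn1 (leq_exp2l _ _ (prime_gt1 p_pr)).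
  apply: dvdn_leq; first exact: order_gt0.
  have [m o_l] := p_natP (mem_p_elt pL Ll); move: l_neq1.
  rewrite -order_eq1 -/(order l) o_l; case: m {o_l} => // m _.
  by rewrite expnS dvdn_mulr.
have [k Kk /= k01] := atransP2 trK (in_setT (0%R, 0%R)) (in_setT (0%R, 1%R)).
(* Compare the action of a on <[l]> at the points 0 and 1 of the base. *)
have c0 : c = 0%R.
  have: k \in L * A :^ x by rewrite defK.
  case/mulsgP=> l1 a Ll1 Aa def_k.
  have /imsetP[[d z] _ def_a] := subsetP sAT a Aa.
  have z1 : z = 1%R.
    have /imsetP[b _ def_l1] := subsetP sLP l1 Ll1.
    move: k01; rewrite def_k def_l1 def_a /aperm permM !fibE.
    by case/pair_equal_spec=> _ ->; rewrite !trE !add0r.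
  have Ka : a \in (H :^ x)%G by rewrite (subsetP (pHall_sub hallAx)).
  have nPa : a \in 'N(hol_p).
    exact: subsetP (subset_trans sKhol (normal_norm hol_p_normal)) a Ka.
  have: l ^ a \in <[l]>.
    rewrite -def_L -defL inE memJ_norm // (subsetP sLP) //= groupJ //.
    exact: subsetP sLK l Ll.
  case/cycleP=> m def_la; apply/eqP; apply: contraT => nz_c.
  have: a * l ^+ m = l * a by rewrite -def_la -conjgC.
  rewrite lX def_l def_a z1 !fibM => /(fib_eq 0%R)[_ eq_b _].
  pose W : F := val w.
  have eq0 : (1 * (0 * 1 + 0) + (u *+ m * W + c *+ m)
              = val d * (u * 1 + c) + (0 * 1 + 0) :> F)%R.
    by have := eq_b 0%R; rewrite !trE !add0r.
  have eq1 : (1 * (0 * W + 0) + (u *+ m * (W * W) + c *+ m)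
              = val d * (u * W + c) + (0 * W + 0) :> F)%R.
    by have := eq_b 1%R; rewrite !trE addr0 expg_ZnD ?twoq_gt1.
  have nz_W : (W - 1 != 0)%R by rewrite subr_eq0; apply: w_neq1.
  have mW : (m%:R * W = val d :> F)%R.
    apply: (mulfI nz_u); apply: (mulIf nz_W).
    transitivity ((1 * (0 * W + 0) + (u *+ m * (W * W) + c *+ m)) -
                  (1 * (0 * 1 + 0) + (u *+ m * W + c *+ m)))%R; first by ring.
    by rewrite eq0 eq1; ring.
  have md : (m%:R = val d :> F)%R.
    apply: (mulfI nz_c).
    transitivity ((1 * (0 * 1 + 0) + (u *+ m * W + c *+ m)) - u * (m%:R * W))%R.
      by ring.
    by rewrite eq0 mW; ring.
  have nz_d : (val d != 0 :> F)%R by rewrite -unitfE (valP d).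
  have: (val d * (W - 1) = 0)%R by rewrite mulrBr -{1}md mW mulr1 subrr.
  by move/eqP; rewrite mulf_eq0 (negbTE nz_d) (negbTE nz_W).
move: def_L lX; rewrite c0 => def_L lX.
exists (x * hol_inversion); rewrite conjsgM; apply/subsetP=> _ /imsetP[h Kh ->].
move: Kh; rewrite -defK def_L => /mulsgP[_ a /cycleP[m ->] Aa ->].
have /imsetP[[d z] _ ->] := subsetP sAT a Aa.
have -> : l ^+ m * hol_elt (d, (0%R, 0%R), z)
           = hol_elt (d, (val d * (u *+ m), 0)%R, z).
  rewrite lX !fibM mulg1 /= tr_0 mul1g; apply: eq_fib => y.
  by rewrite mul0rn perm1 /=; ring.
exact: hol_inversionJ.
Qed.

End CyclicHolomorph.

(** * A dihedral regular group on Z/n *)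

Section DihedralStructure.

Variables (p n : nat).
Hypotheses (p_pr : prime p) (n_gt1 : 1 < n) (n_even : ~~ odd n).
Local Notation F := 'F_p.
Local Notation Z := 'Z_n.

(** Since n is even, odd z only depends on the class of z. *)
Lemma dih_inj (z : Z) : injective (fun y : Z => (-1) ^+ odd z * y + z)%R.
Proof. by move=> y y' /addIr/(can_inj (signrMK _)). Qed.

Definition dih (z : Z) : {perm Z} := perm (@dih_inj z).

Lemma dihE z y : dih z y = ((-1) ^+ odd z * y + z)%R.
Proof. by rewrite permE. Qed.

Lemma dih0 z : dih z 0%R = z.
Proof. by rewrite dihE mulr0 add0r. Qed.

Lemma odd_ZnD (y z : Z) : odd (y + z : Z)%R = odd y (+) odd z.
Proof. by rewrite /= odd_mod ?oddD // Zp_cast // (negbTE n_even). Qed.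

Lemma odd_ZnN (z : Z) : odd (- z : Z)%R = odd z.
Proof. 
have: odd (- z : Z)%R (+) odd z = false by rewrite -odd_ZnD addNr.
by case: (odd z); case: (odd _).
Qed.

Lemma odd_Zn_sign (b : bool) (z : Z) : odd ((-1) ^+ b * z : Z)%R = odd z.
Proof. by rewrite mulr_sign; case: b; rewrite ?odd_ZnN. Qed.

Lemma odd_dih z y : odd (dih z y) = odd z (+) odd y.
Proof. by rewrite dihE odd_ZnD odd_Zn_sign addbC. Qed.

Lemma dihM z w : dih z * dih w = dih (dih w z).
Proof.
apply/permP=> y; rewrite permM [RHS]dihE odd_dih !dihE signr_addb.
by ring.
Qed.

(** The parity of z tells reflections from rotations, so this is a character
    of the dihedral group, trivial on the rotations. *)
Lemma chi_dih (e : {unit F}) : e ^+ 2 = 1 ->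
  forall z y : Z, e ^+ odd (dih y z) = e ^+ odd y * e ^+ odd z.
Proof.
move=> e2 z y; rewrite odd_dih.
by case: (odd y) (odd z) => [] [] //=; rewrite ?mulg1 ?mul1g // -e2.
Qed.

Lemma affine_translations_norm_dih (e : {unit F}) :
  affine_translations p n \subset
    'N(fibred_regular (fun z : Z => e ^+ odd z) dih).
Proof.
apply: affine_translations_norm => w z.
exists (z + (w - (-1) ^+ odd z * w))%R; last first.
  by rewrite !odd_ZnD odd_ZnN odd_Zn_sign addbb addbF.
apply/permP=> y; rewrite !permM !dihE !trE.
rewrite !odd_ZnD odd_ZnN odd_Zn_sign addbb addbF.
by ring.
Qed.

End DihedralStructure.

Lemma affine_translations_norm_tr (p n : nat) (w : {unit 'F_p}) :
  affine_translations p n \subset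
    'N(fibred_regular (fun z : 'Z_n => w ^+ z) (@tr n)).
Proof.
by apply: affine_translations_norm => y z; exists z; rewrite // trC.
Qed.

(** * Recognising cyclic, dihedral and metacyclic groups *)

(** The value of the presentation term [term_expz t k] when t has value x. *)
Definition expgz (gT : finGroupType) (x : gT) (k : int) : gT :=
  if k is Negz m then x ^- m.+1 else x ^+ `|k|.

Lemma eval_term_expz (gT : finGroupType) (e : seq gT) t k :
  Presentation.eval e (term_expz t k) = expgz (Presentation.eval e t) k.
Proof. by case: k. Qed.

Lemma expgz_cycle (gT : finGroupType) (x : gT) k : expgz x k \in <[x]>.
Proof. by case: k => m; rewrite /= ?groupV mem_cycle. Qed.

(** For N defined by a presentation, M \homg N only requires generators of M
    that satisfy the relations, and the relations bound #|N|. *)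
Lemma isog_of_homg (gT rT : finGroupType) (N : {group gT}) (M : {group rT}) :
  M \homg N -> #|N| <= #|M| -> N \isog M.
Proof. by move=> hMN leNM; rewrite isog_sym isogEcard hMN. Qed.

Lemma leq_card_joing_cycle (gT : finGroupType) (A : {group gT}) (x : gT) m :
  0 < m -> x ^+ m = 1 -> x \in 'N(A) -> #|A <*> <[x]>| <= #|A| * m.
Proof.
move=> m_gt0 xm nAx; rewrite norm_joinEr ?cycle_subG //.
apply: leq_trans (_ : #|A| * #[x] <= _); last first.
  by rewrite leq_mul2l dvdn_leq ?orbT // order_dvdn xm.
by rewrite /order mul_cardG leq_pmulr ?cardG_gt0.
Qed.

(** The relations make <x, y> a quotient of the dihedral group, and the orders
    m and 2, coprime as m is odd, prevent a collapse. *)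
Lemma isog_dihedral (gT : finGroupType) (x y : gT) m :
    1 < m -> odd m -> #[x] = m -> #[y] = 2 -> x ^ y = x^-1 ->
  [set: 'D_(2 * m)] \isog <[x]> <*> <[y]>.
Proof.
move=> m_gt1 m_odd ox oy xy; rewrite mul2n.
have dvd2m : (m * 2) %| #|<[x]> <*> <[y]>|.
  rewrite Gauss_dvd ?coprimen2 // -{1}ox -oy.
  by rewrite !order_dvdG ?mem_gen // inE cycle_id ?orbT.
rewrite isog_sym isogEcard card_dihedral // -muln2 dvdn_leq ?cardG_gt0 // andbT.
rewrite muln2 (Grp_dihedral m_gt1); apply/existsP; exists (x, y).
by rewrite /= !xpair_eqE -{1}ox -{1}oy !expg_order xy !eqxx.
Qed.

Lemma isog_prod_dprod (gT rT sT : finGroupType) (A B M : {group gT}) :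
    A \x B = M -> [set: rT] \isog A -> [set: sT] \isog B ->
  [set: (rT * sT)%type] \isog M.
Proof.
move=> defM isoA isoB.
have -> : [set: (rT * sT)%type] = setX [set: rT] [set: sT].
  by apply/setP=> -[a b]; rewrite !inE.
have iso1 : [set: rT] \isog setX [set: rT] [1 sT].
  by rewrite -morphim_pairg1 sub_isog ?subsetT ?injm_pairg1.
have iso2 : [set: sT] \isog setX [1 rT] [set: sT].
  by rewrite -morphim_pair1g sub_isog ?subsetT ?injm_pair1g.
apply: isog_dprod (setX_dprod _ _) defM _ _.
  by apply: isog_trans isoA; rewrite isog_sym.
by apply: isog_trans isoB; rewrite isog_sym.
Qed.

Lemma dprod_coprime_card (gT : finGroupType) (A B M : {group gT}) :
    A \subset M -> B \subset M -> B \subset 'C(A) ->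
    coprime #|A| #|B| -> #|M| = (#|A| * #|B|)%N ->
  A \x B = M.
Proof.
move=> sAM sBM cAB coAB oM; rewrite dprodE ?coprime_TIg //.
by apply/eqP; rewrite eqEcard mul_subG // coprime_cardMg // oM leqnn.
Qed.

Lemma eq_group_orders (gT : finGroupType) (A M : {group gT}) (p q : nat) a b c :
    prime p -> prime q -> odd p -> odd q -> q < p ->
    A \subset M -> #|M| = (2 * p * q)%N -> a \in A -> b \in A -> c \in A ->
    #[a] = 2 -> #[b] = p -> #[c] = q ->
  A :=: M.
Proof.
move=> p_pr q_pr p_odd q_odd ltqp sAM oM Aa Ab Ac oa ob oc.
apply/eqP; rewrite eqEcard sAM oM dvdn_leq ?cardG_gt0 //.
have co_pq : coprime p q.
  by rewrite coprime_sym prime_coprime // dvdn_prime2 // ltn_eqF.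
rewrite !Gauss_dvd ?coprimeMl ?coprime2n ?q_odd ?co_pq //.
by rewrite -oa -{1}ob -oc !order_dvdG.
Qed.

Lemma mem_norm_cycle (gT : finGroupType) (x s : gT) :
  s * x * s^-1 \in <[x]> -> s \in 'N(<[x]>).
Proof.
move=> x_s; rewrite -groupV inE -cycleJ cycle_subG.
by rewrite conjgE invgK mulgA.
Qed.

Lemma leq_card_C2_metacyclic (gT : finGroupType) (x r s : gT) p q k :
    0 < p -> 0 < q -> x ^+ 2 = 1 -> r ^+ p = 1 -> s ^+ q = 1 ->
    s * r * s^-1 = expgz r k -> s * x * s^-1 = x -> r * x * r^-1 = x ->
  #|<[x]> <*> <[r]> <*> <[s]>| <= 2 * p * q.
Proof.
move=> p_gt0 q_gt0 x2 rp sq rs xs xr.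
have nxr : r \in 'N(<[x]>) by rewrite mem_norm_cycle // xr cycle_id.
have nxs : s \in 'N(<[x]>) by rewrite mem_norm_cycle // xs cycle_id.
have nrs : s \in 'N(<[r]>) by rewrite mem_norm_cycle // rs expgz_cycle.
have nxrs : s \in 'N(<[x]> <*> <[r]>) by rewrite -cycle_subG normsY ?cycle_subG.
apply: leq_trans (leq_card_joing_cycle q_gt0 sq nxrs) _; rewrite leq_mul2r.
apply/orP; right; apply: leq_trans (leq_card_joing_cycle p_gt0 rp nxr) _.
by rewrite leq_mul2r dvdn_leq ?orbT // order_dvdn x2.
Qed.

Lemma leq_card_metacyclic (gT : finGroupType) (r s : gT) p n k :
    0 < p -> 0 < n -> r ^+ p = 1 -> s ^+ n = 1 -> s * r * s^-1 = expgz r k ->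
  #|<[r]> <*> <[s]>| <= p * n.
Proof.
move=> p_gt0 n_gt0 rp sn rs.
have nrs : s \in 'N(<[r]>) by rewrite mem_norm_cycle // rs expgz_cycle.
apply: leq_trans (leq_card_joing_cycle n_gt0 sn nrs) _.
by rewrite leq_mul2r dvdn_leq ?orbT // order_dvdn rp.
Qed.

(** * The six groups as fibred regular groups *)

Lemma cyclic_Zn n : cyclic [set: 'Z_n].
Proof. by apply/cyclicP; exists Zp1; apply: Zp_cycle. Qed.

Section Models.

Variables (p q : nat).
Hypotheses (p_pr : prime p) (q_pr : prime q) (p_odd : odd p) (q_odd : odd q).
Hypotheses (q_lt_p : q < p) (n_lt_p : 2 * q < p).
Local Notation F := 'F_p.
Local Notation Z := 'Z_(2 * q).
Local Notation n_gt1 := (twoq_gt1 (prime_gt1 q_pr)).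
Local Notation r := (fib 1 (fun=> 1%R) 1 : {perm F * Z}).

Lemma card_model : #|{: F * Z}| = (2 * p * q)%N.
Proof. by rewrite card_prod (card_Fp p_pr) (card_Zn n_gt1); ring. Qed.

Lemma order_r : #[r] = p.
Proof.
apply: nt_prime_order => //.
  rewrite shiftX -fib1; apply: eq_fib => y.
  by rewrite -mulr_natr pchar_Fp_0 ?mulr0.
apply/eqP; rewrite -fib1 => /(fib_eq 0%R)[_ /(_ 0%R)/eqP].
by rewrite oner_eq0.
Qed.

Lemma rJ (d : {unit F}) b (t : {perm Z}) :
  r ^ fib d b t = fib 1 (fun=> val d) 1.
Proof. by rewrite shiftJ; apply: eq_fib => y; rewrite mulr1. Qed.

Lemma fib0X (d : {unit F}) (t : {perm Z}) m :
  fib d (fun=> 0%R) t ^+ m = fib (d ^+ m) (fun=> 0%R) (t ^+ m).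
Proof.
elim: m => [|m IHm]; first by rewrite expg0 -fib1.
rewrite expgSr IHm fibM -expgS -expgSr; apply: eq_fib => y.
by rewrite mulr0 addr0.
Qed.

Lemma trX (z : Z) m : tr z ^+ m = tr (z *+ m)%R.
Proof.
elim: m => [|m IHm]; first by rewrite mulr0n tr_0.
by rewrite expgSr IHm trM trE mulrSr.
Qed.

Lemma Zn_nat_eq0 m : (m%:R == 0 :> Z)%R = (2 * q %| m).
Proof. by rewrite -val_eqE /= val_Zp_nat ?n_gt1. Qed.

Lemma expgz_r k : expgz r k = fib 1 (fun=> k%:~R)%R 1.
Proof.
case: k => m; rewrite /= shiftX //.
apply/eqP; rewrite eq_invg_mul fibM !mulg1 -fib1; apply/eqP.
by apply: eq_fib => y; rewrite NegzE mulrNz mul1r subrr.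
Qed.

Section CyclicModel.

Variables (w : {unit F}).
Hypothesis (wn : w ^+ (2 * q) = 1).
Local Notation M :=
  (fibred_regular_group (@tr0 (2 * q)) (@trM (2 * q)) (chi_tr n_gt1 wn)).
Local Notation s := (fib w (fun=> 0%R) (tr 1%R) : {perm F * Z}).

Lemma card_cyclic_model : #|M| = (2 * p * q)%N.
Proof. by rewrite (card_fibred_regular _ (@tr0 _)) card_model. Qed.

Lemma mem_cyclic_model_r : r \in M.
Proof. by apply/imsetP; exists (1%R, 0%R); rewrite // /freg /= tr_0. Qed.

Lemma mem_cyclic_model_s : s \in M.
Proof. by apply/imsetP; exists (0%R, 1%R). Qed.

Lemma order_s : #[s] = (2 * q)%N.
Proof.
apply/eqP; rewrite eqn_dvd order_dvdn fib0X wn trX.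
have/eqP-> : (1 *+ (2 * q) == 0 :> Z)%R by rewrite Zn_nat_eq0.
rewrite tr_0 fib1 eqxx /= -Zn_nat_eq0.
have := expg_order s; rewrite fib0X -fib1 => /(fib_eq 0%R)[_ _].
by rewrite trX -tr_0 => /tr_inj->.
Qed.

Lemma rJs m : r ^ (s ^+ m) = fib 1 (fun=> val (w ^+ m)%g) 1.
Proof. by rewrite fib0X rJ. Qed.

Lemma gen_cyclic_model (A : {group {perm F * Z}}) :
  A \subset M -> r \in A -> s \in A -> A :=: M.
Proof.
move=> sAM Ar As.
apply: (eq_group_orders p_pr q_pr p_odd q_odd q_lt_p sAM card_cyclic_model
          (groupX q As) Ar (groupX 2 As)) order_r _.
  by rewrite orderXdiv order_s ?dvdn_mull // mulnK // prime_gt0.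
by rewrite orderXdiv order_s ?dvdn_mulr // mulKn.
Qed.

Lemma cyclic_model_1 : w = 1 -> [set: 'Z_(2 * p * q)] \isog M.
Proof.
move=> w1; have pq1 : 1 < 2 * p * q.
  by rewrite -mulnA leq_pmulr // muln_gt0 !prime_gt0.
have o_rs : #[r * s] = (2 * p * q)%N.
  rewrite orderM ?order_r ?order_s; first by ring.
    by apply/commgP/conjg_fixP; have := rJs 1; rewrite !expg1 w1.
  rewrite coprimeMr coprime_sym coprime2n p_odd /= coprime_sym.
  by rewrite prime_coprime // dvdn_prime2 // ltn_eqF.
have M_rs : <[r * s]> = M.
  apply/eqP; rewrite eqEcard cycle_subG groupM ?mem_cyclic_model_r //=.
    by rewrite card_cyclic_model -o_rs leqnn.
  exact: mem_cyclic_model_s.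
rewrite isog_cyclic_card -?M_rs ?cycle_cyclic /=.
  by rewrite -orderE o_rs cardsT card_ord Zp_cast.
exact: cyclic_Zn.
Qed.

Lemma cyclic_model_3 :
  (val w = -1)%R -> [set: ('Z_q * 'D_(2 * p))%type] \isog M.
Proof.
move=> w_N1; have p_gt1 := prime_gt1 p_pr.
have w2 : w ^+ 2 = 1 by apply: val_inj; rewrite FinRing.val_unitX w_N1 sqrrN expr1n.
have o_s2 : #[s ^+ 2] = q by rewrite orderXdiv order_s ?dvdn_mulr // mulKn.
have o_sq : #[s ^+ q] = 2 by rewrite orderXdiv order_s ?dvdn_mull // mulnK ?prime_gt0.
have r_sq : r ^ (s ^+ q) = r^-1.
  rewrite rJs FinRing.val_unitX w_N1 -signr_odd q_odd expr1 -/(expgz r (Negz 0)).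
  by rewrite expgz_r.
have isoB := isog_dihedral p_gt1 p_odd order_r o_sq r_sq.
have oB : #|<[r]> <*> <[s ^+ q]>| = (2 * p)%N.
  by rewrite -(card_isog isoB) mul2n card_dihedral.
have cBs2 : <[s ^+ 2]> \subset 'C(<[r]> <*> <[s ^+ q]>).
  rewrite centY !cent_cycle subsetI !cycle_subG; apply/andP; split; apply/cent1P.
    by apply/esym/commgP/conjg_fixP; rewrite rJs w2.
  exact: commuteX2.
apply: (isog_prod_dprod (A := <[s ^+ 2]>%G) _ _ isoB).
  apply: dprod_coprime_card; last by rewrite /= -orderE o_s2 oB card_cyclic_model; ring.
  - by rewrite cycle_subG groupX // mem_cyclic_model_s.
  - by rewrite join_subG !cycle_subG mem_cyclic_model_r groupX ?mem_cyclic_model_s.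
  - by rewrite centsC.
  rewrite /= -orderE o_s2 oB coprimeMr coprime_sym coprime2n q_odd /=.
  by rewrite prime_coprime // dvdn_prime2 // ltn_eqF.
rewrite isog_cyclic_card; last first.
  exact: cyclic_Zn.
rewrite cycle_cyclic -orderE o_s2 cardsT card_ord Zp_cast ?eqxx //.
exact: prime_gt1.
Qed.

(** Take s^q for the central involution and s^-(q+1) for the element of order
    q: since w^q = 1, the power s^(q+1) still acts as w. The inverse is there
    because r ^ s is s^-1 r s, whereas the relation reads s r s^-1. *)
Lemma cyclic_model_5 (k : int) (N : finGroupType) :
  w ^+ q = 1 -> (val w = k%:~R)%R -> is_N p q k 5 N -> [set: N] \isog M.
Proof.
move=> wq w_k N5; apply: isog_of_homg; last first.
  rewrite card_cyclic_model; have /existsP[[[x a] b] /=] := isoGrp_hom N5.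
  rewrite eval_term_expz !xpair_eqE /=.
  case/and3P=> /eqP <- /eqP x2 /and5P[/eqP ap /eqP bq /eqP ab /eqP xb /eqP xa].
  exact: (leq_card_C2_metacyclic (prime_gt0 p_pr) (prime_gt0 q_pr) x2 ap bq ab xb xa).
rewrite [homg _ _]N5; apply/existsP; exists (s ^+ q, r, s ^- q.+1) => /=.
have conjV (a b : {perm F * Z}) : a^-1 * b * a^-1^-1 = b ^ a.
  by rewrite invgK conjgE mulgA.
have r_sq : commute r (s ^+ q) by apply/commgP/conjg_fixP; rewrite rJs wq.
rewrite eval_term_expz !xpair_eqE /= !conjV expgz_r.
apply/and3P; split.
- apply/eqP; apply: gen_cyclic_model.
  + rewrite !join_subG !cycle_subG groupV !groupX ?mem_cyclic_model_s //.
    by rewrite mem_cyclic_model_r.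
  + by rewrite mem_gen // inE mem_gen // inE cycle_id orbT.
  rewrite /=; set A := <[_]> <*> <[_]> <*> <[_]>.
  have A1 : s ^+ q \in A by rewrite mem_gen // inE mem_gen // inE cycle_id.
  have A2 : s ^+ q.+1 \in A by rewrite -groupV mem_gen // inE cycle_id orbT.
  by rewrite -(groupMr _ A1) -expgS.
- by rewrite -expgM -order_dvdn order_s mulnC.
apply/and5P; split; apply/eqP.
- by apply/eqP; rewrite -order_dvdn order_r.
- rewrite expgVn -expgM; apply/eqP; rewrite eq_invg1 -order_dvdn order_s.
  by rewrite dvdn_mul // dvdn2 /= q_odd.
- by rewrite rJs expgS wq mulg1 w_k.
- by apply/conjg_fixP/commgP/commuteX2.
by rewrite r_sq mulgK.
Qed.

Lemma cyclic_model_6 (k : int) (N : finGroupType) :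
  (val w = - k%:~R)%R -> is_N p q k 6 N -> [set: N] \isog M.
Proof.
move=> w_k N6; apply: isog_of_homg; last first.
  rewrite card_cyclic_model; have /existsP[[a b] /=] := isoGrp_hom N6.
  rewrite eval_term_expz !xpair_eqE /= => /and4P[/eqP <- /eqP ap /eqP bn /eqP ab].
  have n_gt0 := ltnW n_gt1.
  have := leq_card_metacyclic (prime_gt0 p_pr) n_gt0 ap bn ab.
  by rewrite mulnCA mulnA.
rewrite [homg _ _]N6; apply/existsP; exists (r, s^-1) => /=.
have conjV (a b : {perm F * Z}) : a^-1 * b * a^-1^-1 = b ^ a.
  by rewrite invgK conjgE mulgA.
rewrite eval_term_expz !xpair_eqE /= conjV expgz_r.
apply/and4P; split; apply/eqP.
- apply: gen_cyclic_model.
  + by rewrite join_subG !cycle_subG groupV mem_cyclic_model_r mem_cyclic_model_s.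
  + by rewrite mem_gen // inE cycle_id.
  by rewrite -groupV mem_gen // inE cycle_id orbT.
- by apply/eqP; rewrite -order_dvdn order_r.
- by apply/eqP; rewrite expgVn eq_invg1 -order_dvdn order_s.
by rewrite -[s]expg1 rJs expg1 w_k mulrNz.
Qed.

End CyclicModel.
Section DihedralModel.

Variables (e : {unit F}).
Hypothesis (e2 : e ^+ 2 = 1).

Lemma n_even : ~~ odd (2 * q).
Proof. by rewrite oddM. Qed.

Local Notation M := (fibred_regular_group (@dih0 (2 * q))
  (dihM n_gt1 n_even) (chi_dih n_gt1 n_even e2)).
Local Notation t := (fib 1 (fun=> 0%R) (tr 2%:R%R) : {perm F * Z}).
Local Notation y := (fib e (fun=> 0%R) (dih 1%R) : {perm F * Z}).

Lemma card_dihedral_model : #|M| = (2 * p * q)%N.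
Proof. by rewrite (card_fibred_regular _ (@dih0 _)) card_model. Qed.

Lemma dih_even (z : Z) : ~~ odd z -> dih z = tr z.
Proof.
move/negbTE=> z_even; apply/permP=> z'.
by rewrite dihE trE z_even mul1r.
Qed.

Lemma odd_Zn2 : odd (2%:R : Z)%R = false.
Proof.
by rewrite val_Zp_nat ?n_gt1 // odd_mod // (negbTE n_even).
Qed.

Lemma mem_dihedral_model_r : r \in M.
Proof.
apply/imsetP; exists (1%R, 0%R); rewrite // /freg /= dih_even //.
by rewrite tr_0.
Qed.

Lemma mem_dihedral_model_t : t \in M.
Proof.
apply/imsetP; exists (0%R, 2%:R%R); rewrite // /freg.
by rewrite [snd _]/= odd_Zn2 dih_even ?odd_Zn2.
Qed.

Lemma mem_dihedral_model_y : y \in M.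
Proof. by apply/imsetP; exists (0%R, 1%R). Qed.

Lemma order_t : #[t] = q.
Proof.
apply: nt_prime_order => //.
  rewrite fib0X trX expg1n -fib1; congr (fib _ _ _).
  by rewrite -tr_0 -mulrnA; congr tr; apply/eqP; rewrite Zn_nat_eq0.
apply/eqP; rewrite -fib1 -tr_0 => /(fib_eq 0%R)[_ _ /tr_inj/eqP].
rewrite Zn_nat_eq0 -{2}[2]muln1 dvdn_pmul2l // dvdn1 => /eqP q1.
by move: q_pr; rewrite q1.
Qed.

Lemma order_y : #[y] = 2.
Proof.
apply: nt_prime_order => //.
  rewrite fib0X e2 expgS expg1 (dihM n_gt1 n_even) -fib1; congr (fib _ _ _).
  by rewrite dihE /= mulN1r addNr dih_even ?tr_0.
apply/eqP; rewrite -fib1 => /(fib_eq 0%R)[_ _].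
move/(congr1 (fun s : {perm Z} => s 0%R)).
by rewrite dih0 perm1 => /eqP; rewrite oner_eq0.
Qed.

Lemma tJy : t ^ y = t^-1.
Proof.
have tyt : t * y * t = y.
  rewrite !fibM !mulg1 mul1g.
  have -> : tr 2%:R%R * dih 1%R * tr 2%:R%R = dih 1%R :> {perm Z}.
    by apply/permP=> z; rewrite !permM !trE !dihE !mulN1r; ring.
  by apply: eq_fib => z; rewrite /=; ring.
by apply: (mulIg t); rewrite mulVg conjgE -!mulgA (mulgA t) tyt mulVg.
Qed.

Lemma commute_r_t : commute r t.
Proof. by apply/commgP/conjg_fixP; rewrite rJ. Qed.

Lemma dihedral_model_2 : e = 1 -> [set: ('Z_p * 'D_(2 * q))%type] \isog M.
Proof.
move=> e1; have q_gt1 := prime_gt1 q_pr.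
have isoB := isog_dihedral q_gt1 q_odd order_t order_y tJy.
have oB : #|<[t]> <*> <[y]>| = (2 * q)%N.
  by rewrite -(card_isog isoB) mul2n card_dihedral.
apply: (isog_prod_dprod (A := <[r]>%G) _ _ isoB).
  apply: dprod_coprime_card.
  - by rewrite cycle_subG mem_dihedral_model_r.
  - by rewrite join_subG !cycle_subG mem_dihedral_model_t mem_dihedral_model_y.
  - rewrite centsC /= centY !cent_cycle subsetI !cycle_subG.
    apply/andP; split; apply/cent1P; first exact: commute_r_t.
    by apply/commgP/conjg_fixP; rewrite rJ e1.
  - rewrite /= -orderE order_r oB coprimeMr coprime_sym coprime2n p_odd /=.
    by rewrite prime_coprime // dvdn_prime2 // gtn_eqF.
  by rewrite /= -orderE order_r oB card_dihedral_model; ring.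
rewrite isog_cyclic_card ?cyclic_Zn // cycle_cyclic -orderE order_r.
by rewrite cardsT card_ord Zp_cast ?eqxx // prime_gt1.
Qed.

Lemma dihedral_model_4 : (val e = -1)%R -> [set: 'D_(2 * (p * q))] \isog M.
Proof.
move=> e_N1; have pq_gt1 : 1 < p * q.
  by rewrite (leq_trans (prime_gt1 p_pr)) // leq_pmulr // prime_gt0.
have pq_odd : odd (p * q) by rewrite oddM p_odd.
have o_rt : #[r * t] = (p * q)%N.
  rewrite orderM ?order_r ?order_t //; first exact: commute_r_t.
  by rewrite prime_coprime // dvdn_prime2 // gtn_eqF.
have rJy : r ^ y = r^-1.
  by rewrite rJ e_N1 -/(expgz r (Negz 0)) expgz_r.
have rtJy : (r * t) ^ y = (r * t)^-1.
  by rewrite conjMg rJy tJy commute_r_t invMg.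
have isoB := isog_dihedral pq_gt1 pq_odd o_rt order_y rtJy.
have oB : #|<[r * t]> <*> <[y]>| = (2 * (p * q))%N.
  by rewrite -(card_isog isoB) mul2n card_dihedral.
have <- : <[r * t]> <*> <[y]> = M; last exact: isoB.
apply/eqP; rewrite eqEcard join_subG !cycle_subG mem_dihedral_model_y.
rewrite groupM ?mem_dihedral_model_r ?mem_dihedral_model_t //=.
by rewrite card_dihedral_model oB mulnA.
Qed.

End DihedralModel.
End Models.

(** * Models of N_1, ..., N_6 *)

Definition fibred_model (p n : nat) (N : finGroupType)
    (chi : 'Z_n -> {unit 'F_p}) (tau : 'Z_n -> {perm 'Z_n}) : Prop :=
  [/\ forall z, tau z 0%R = z,
      forall z y, tau z * tau y = tau (tau y z),
      forall z y, chi (tau y z) = chi y * chi z,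
      affine_translations p n \subset 'N(fibred_regular chi tau)
    & [set: N] \isog fibred_regular chi tau].

Lemma admissible_fibred_model (p n : nat) (N : finGroupType) chi tau
    (gT : finGroupType) (G : {group gT}) :
  @fibred_model p n N chi tau ->
  admissible G N <-> transitive_in_normaliser (fibred_regular chi tau) G.
Proof.
case=> tau0 tauM chiM _ isoN.
exact: (@admissible_regular _ (fibred_regular_group tau0 tauM chiM) (0%R, 0%R)
  _ _ _ (freg_semiregular tau0) (card_fibred_regular chi tau0) isoN).
Qed.

Section Classification.

Variables (p q : nat) (k : int).
Hypotheses (p_pr : prime p) (q_pr : prime q) (p_odd : odd p) (q_odd : odd q).
Hypotheses (q_lt_p : q < p) (n_lt_p : 2 * q < p).
Hypothesis k_order : (q.-primitive_root (k%:~R : 'F_p))%R.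
Local Notation F := 'F_p.
Local Notation Z := 'Z_(2 * q).
Local Notation n_gt1 := (twoq_gt1 (prime_gt1 q_pr)).

Definition minus1 : {unit F} := FinRing.unit F (unitrN1 F).

Lemma minus1_sqr : minus1 ^+ 2 = 1.
Proof. by apply: val_inj; rewrite FinRing.val_unitX sqrrN expr1n. Qed.

Lemma k_unit : (k%:~R : F)%R \is a GRing.unit.
Proof.
apply/unitrP; exists (k%:~R ^+ q.-1)%R; rewrite -exprSr -exprS.
by rewrite prednK ?prime_gt0 // (prim_expr_order k_order).
Qed.

Definition k_elt : {unit F} := FinRing.unit F k_unit.

Lemma k_elt_exp : k_elt ^+ q = 1.
Proof.
by apply: val_inj; rewrite FinRing.val_unitX /= (prim_expr_order k_order).
Qed.

Lemma order_k_elt : #[k_elt] = q.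
Proof.
apply: nt_prime_order k_elt_exp _ => //.
apply/eqP=> /(congr1 val) /= k1; move: k_order; rewrite k1 => /prim_order_dvd.
by move/(_ 1%N); rewrite expr1n eqxx dvdn1 => /eqP q1; move: q_pr; rewrite q1.
Qed.

(** The slope of a generator of the complement in N_5 (for i = 5) and in N_6
    (for i = 6). *)
Definition omega (i : nat) : {unit F} :=
  if i == 5 then k_elt else minus1 * k_elt.

Lemma omega_2q i : omega i ^+ (2 * q) = 1.
Proof.
have k2q : k_elt ^+ (2 * q) = 1 by rewrite mulnC expgM k_elt_exp expg1n.
rewrite /omega; case: ifP => // _.
by rewrite expgMn ?k2q ?expgM ?minus1_sqr ?expg1n ?mulg1 //; apply: unit_mulC.
Qed.

Lemma omega_sqr i : omega i ^+ 2 = k_elt ^+ 2.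
Proof.
rewrite /omega; case: ifP => // _.
by rewrite expgMn ?minus1_sqr ?mul1g //; apply: unit_mulC.
Qed.

(** The square of -k is that of k, and k^2 still has the odd order q. *)
Lemma dvdn_order_omega i : q %| #[omega i].
Proof.
have : #[omega i ^+ 2] = q.
  rewrite omega_sqr orderXgcd order_k_elt (eqP (_ : coprime q 2)) ?divn1 //.
  by rewrite coprimen2.
by move=> {1}<-; rewrite orderXgcd dvdn_div // dvdn_gcdl.
Qed.

Lemma omega_sqr_neq1 i : omega i ^+ 2 != 1.
Proof.
rewrite omega_sqr -order_dvdn order_k_elt dvdn_prime2 //.
by apply: contraL q_odd => /eqP->.
Qed.

Lemma omega6_q_neq1 : omega 6 ^+ q != 1.
Proof.
rewrite /omega /= expgMn ?k_elt_exp ?mulg1; last exact: unit_mulC.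
apply/eqP=> /(congr1 val); rewrite FinRing.val_unitX -signr_odd q_odd expr1.
move/eqP; rewrite eq_sym -subr_eq0 opprK -[(1 + 1)%R]/(2%:R)%R.
rewrite -(dvdn_pcharf (pchar_Fp p_pr)) dvdn_prime2 // => /eqP p2.
by move: p_odd; rewrite p2.
Qed.

Lemma fibred_model_cyclic (w : {unit F}) (N : finGroupType) :
    w ^+ (2 * q) = 1 ->
    [set: N] \isog fibred_regular (fun z : Z => w ^+ z) (@tr (2 * q)) ->
  fibred_model N (fun z : Z => w ^+ z) (@tr (2 * q)).
Proof.
move=> wn isoN; split=> //.
- exact: tr0.
- exact: trM.
- exact: (chi_tr n_gt1 wn).
exact: affine_translations_norm_tr.
Qed.

Lemma fibred_model_dihedral (e : {unit F}) (N : finGroupType) :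
    e ^+ 2 = 1 ->
    [set: N] \isog fibred_regular (fun z : Z => e ^+ odd z) (@dih (2 * q)) ->
  fibred_model N (fun z : Z => e ^+ odd z) (@dih (2 * q)).
Proof.
move=> e2 isoN; have nE := n_even q; split=> //.
- exact: dih0.
- exact: (dihM n_gt1 nE).
- exact: (chi_dih n_gt1 nE e2).
exact: (affine_translations_norm_dih n_gt1 nE e).
Qed.

Lemma fibred_model_56 i (N : finGroupType) : i = 5 \/ i = 6 ->
  is_N p q k i N -> fibred_model N (fun z : Z => omega i ^+ z) (@tr (2 * q)).
Proof.
move=> i56 Ni; apply: fibred_model_cyclic (omega_2q i) _.
case: i56 Ni (omega_2q i) => -> Ni wn.
  exact: (cyclic_model_5 p_pr q_pr p_odd q_odd q_lt_p wn k_elt_exp _ Ni).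
apply: (cyclic_model_6 p_pr q_pr p_odd q_odd q_lt_p wn _ Ni).
by rewrite /omega /= mulN1r.
Qed.

Lemma fibred_model_1234 j (N : finGroupType) : 0 < j <= 4 ->
    is_N p q k j N ->
  exists chi tau, @fibred_model p (2 * q) N chi tau /\ forall z, chi z ^+ 2 = 1.
Proof.
have m1_2q : minus1 ^+ (2 * q) = 1 by rewrite expgM minus1_sqr expg1n.
have one_2q : (1 : {unit F}) ^+ (2 * q) = 1 by rewrite expg1n.
have one_2 : (1 : {unit F}) ^+ 2 = 1 by rewrite expg1n.
case: j => [|[|[|[|[|j]]]]] //= _ isoN.
- exists (fun z : Z => 1 ^+ z), (@tr (2 * q)); split=> [|z]; last by rewrite !expg1n.
  apply: (fibred_model_cyclic one_2q).
  exact: isog_trans isoN (cyclic_model_1 p_pr q_pr p_odd q_lt_p one_2q erefl).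
- exists (fun z : Z => 1 ^+ odd z), (@dih (2 * q)); split=> [|z]; last by rewrite !expg1n.
  apply: (fibred_model_dihedral one_2).
  exact: isog_trans isoN (dihedral_model_2 p_pr q_pr p_odd q_odd q_lt_p one_2 erefl).
- exists (fun z : Z => minus1 ^+ z), (@tr (2 * q)).
  split=> [|z]; last by rewrite -expgM mulnC expgM minus1_sqr expg1n.
  apply: (fibred_model_cyclic m1_2q).
  exact: isog_trans isoN (cyclic_model_3 p_pr q_pr p_odd q_odd q_lt_p m1_2q erefl).
exists (fun z : Z => minus1 ^+ odd z), (@dih (2 * q)).
split=> [|z]; last by rewrite -expgM mulnC expgM minus1_sqr expg1n.
apply: (fibred_model_dihedral minus1_sqr).
exact: isog_trans isoN (dihedral_model_4 p_pr q_pr p_odd q_odd q_lt_p minus1_sqr erefl).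
Qed.

End Classification.

(** * The equivalence *)

Lemma dvdn_mul_sqrN (p m n : nat) :
    prime p -> ~~ (p %| m) -> 0 < n -> n %| p ^ 2 * m ->
  (n %| p * m) = ~~ (p ^ 2 %| n).
Proof.
move=> p_pr p_ndvd n_gt0 n_dvd; apply/idP/idP=> [n_pm | p2'n].
  apply: contra p_ndvd => /dvdn_trans/(_ n_pm).
  by rewrite -mulnn dvdn_pmul2l // prime_gt0.
rewrite -(partnC p n_gt0) dvdn_mul //.
  rewrite p_part -[X in _ %| X]expn1 dvdn_exp2l // -ltnS ltnNge.
  by rewrite -pfactor_dvdn.
rewrite -(@Gauss_dvdr _ (p ^ 2)); first exact: dvdn_trans (dvdn_part _ _) n_dvd.
by rewrite coprime_sym (pnat_coprime _ (part_pnat _ _)) // pnatX pnat_id.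
Qed.

(** Both conditions are equivalent to [acts_by_powers p e] for the group G. *)
Lemma fibred_model_exponent (p n e : nat) (N N' : finGroupType) chi tau chi' tau'
    (gT : finGroupType) (G : {group gT}) :
    prime p -> #|{: 'Z_n}| < p -> p ^ 2 %| #|G| ->
    @fibred_model p n N chi tau -> @fibred_model p n N' chi' tau' ->
    admissible G N -> admissible G N' ->
  (forall z, chi z ^+ e = 1) -> forall z, chi' z ^+ e = 1.
Proof.
move=> p_pr ltnp p2G modN modN'.
case/(admissible_fibred_model G modN)=> H [nMH trH isoH].
case/(admissible_fibred_model G modN')=> H' [nMH' trH' isoH'] chi_e.
have [tau0 tauM chiM _ _] := modN; have [tau0' tauM' chiM' _ _] := modN'.
have powH : acts_by_powers p e H.
  exact: (normaliser_acts_by_powers p_pr ltnp tau0 tauM chiM).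
apply: (acts_by_powers_chi p_pr ltnp tau0' tauM' chiM' nMH' trH').
  by rewrite -(card_isog isoH').
by apply: acts_by_powers_isog powH; rewrite -(isog_transl _ isoH).
Qed.

Theorem proposition5p3 (p q : nat)
    (p_prime : prime p) (q_prime : prime q) (p_odd : odd p) (q_odd : odd q)
    (q_lt_p : (q < p)%N) (p_mod_q : p = 1 %[mod q])
    (k : int) (k_order : (q.-primitive_root (k%:~R : 'F_p))%R)
    (N : nat -> finGroupType)
    (N_def : forall j : nat, (1 <= j <= 6)%N -> is_N p q k j (N j))
    (gT : finGroupType) (G : {group gT})
    (i : nat) (i56 : i = 5 \/ i = 6) :
  admissible G (N i) ->
  forall j : nat, (1 <= j <= 6)%N -> j <> i ->
    (admissible G (N j) <-> #|G| %| (2 * p * q * (p - 1))%N).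
Proof.
have q_gt1 := prime_gt1 q_prime; have p_gt1 := prime_gt1 p_prime.
have n_lt_p : 2 * q < p.
  have : 2 * q %| p - 1.
    have q_dvd : q %| p - 1 by rewrite -eqn_mod_dvd ?prime_gt0 // p_mod_q.
    by rewrite Gauss_dvd ?coprime2n // q_dvd dvdn2 oddB ?prime_gt0 // p_odd.
  move/dvdn_leq; rewrite subn_gt0 => /(_ p_gt1).
  by rewrite -ltnS subn1 prednK // prime_gt0.
have Y_lt_p : #|'Z_(2 * q)| < p by rewrite card_Zn ?twoq_gt1.
pose w := omega q_prime k_order; pose chi_ j (z : 'Z_(2 * q)) := w j ^+ z.
have model56 j : j = 5 \/ j = 6 -> fibred_model (N j) (chi_ j) (@tr (2 * q)).
  move=> j56; apply: fibred_model_56 => //; apply: N_def.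
  by case: j56 => ->.
move=> adm_i.
have [H [nMH trH isoGH]] :=
  (admissible_fibred_model G (model56 i i56)).1 adm_i.
have w_2q : w i ^+ (2 * q) = 1 by apply: omega_2q.
have q_w : q %| #[w i] by apply: dvdn_order_omega.
have sHhol : H \subset hol q (w i).
  by apply: subset_trans nMH _; apply: normaliser_sub_hol.
have G_dvd : (#|G| %| 2 * p * q * (p - 1)) = ~~ (p ^ 2 %| #|G|).
  have -> : (2 * p * q * (p - 1) = p * (2 * q * (p - 1)))%N by ring.
  apply: dvdn_mul_sqrN => //.
    rewrite Euclid_dvdM // negb_or (gtnNdvd _ n_lt_p) ?muln_gt0 ?prime_gt0 //=.
    by rewrite gtnNdvd ?subn_gt0 // subn1 ltn_predL prime_gt0.
  have := card_sub_hol p_prime q_gt1 w_2q q_w sHhol.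
  suff <- : (2 * p ^ 2 * q * p.-1 = p ^ 2 * (2 * q * (p - 1)))%N.
    by rewrite -(card_isog isoGH).
  by rewrite subn1; ring.
move=> j j16 j_neq_i; rewrite G_dvd.
have ge5 : 4 < j -> j = 5 \/ j = 6.
  by case/andP: j16 => _; case: (j) => [|[|[|[|[|[|[|?]]]]]]] //; [left | right].
split=> [adm_j | p2'G].
  apply/negP=> p2G.
  (* The exponent 2 separates N_i from N_j for j <= 4, the exponent q separates
     N_5 from N_6. *)
  case: (leqP j 4) => [j4 | /ge5 j56].
    have j14 : 0 < j <= 4 by case/andP: j16 => ->.
    have [chi [tau [mod_j chi_2]]] :=
      fibred_model_1234 p_prime q_prime p_odd q_odd q_lt_p j14 (N_def j j16).
    have := fibred_model_exponent p_prime Y_lt_p p2G mod_j (model56 i i56)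
              adm_j adm_i chi_2 1%R.
    by apply/eqP; apply: omega_sqr_neq1.
  have chi5 z : chi_ 5 z ^+ q = 1.
    by rewrite -expgM mulnC expgM /w /omega /= k_elt_exp expg1n.
  have mod5 := model56 5 (or_introl erefl).
  have mod6 := model56 6 (or_intror erefl).
  have : chi_ 6 1%R ^+ q = 1.
    case: i56 j56 j_neq_i adm_i adm_j => -> [] -> // _ adm adm'.
      exact: (fibred_model_exponent p_prime Y_lt_p p2G mod5 mod6 adm adm' chi5).
    exact: (fibred_model_exponent p_prime Y_lt_p p2G mod5 mod6 adm' adm chi5).
  by apply/eqP; apply: omega6_q_neq1.
have p2'H : ~~ (p ^ 2 %| #|H|) by rewrite -(card_isog isoGH).
have [x sHxW] : exists x, H :^ x \subset affine_translations p (2 * q).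
  exact: (transitive_hol_conj p_prime q_gt1 n_lt_p w_2q q_w sHhol trH p2'H).
have [chi [tau mod_j]] : exists chi tau, @fibred_model p (2 * q) (N j) chi tau.
  case: (leqP j 4) => [j4 | /ge5 j56]; last first.
    by exists (chi_ j), (@tr (2 * q)); apply: model56.
  have j14 : 0 < j <= 4 by case/andP: j16 => ->.
  have [chi [tau [mod_j _]]] :=
    fibred_model_1234 p_prime q_prime p_odd q_odd q_lt_p j14 (N_def j j16).
  by exists chi, tau.
apply/(admissible_fibred_model G mod_j); exists (H :^ x)%G; split.
- by case: mod_j => _ _ _ nMW _; apply: subset_trans sHxW nMW.
- exact: transitive_conj.
exact: isog_trans isoGH (conj_isog H x).
Qed.
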